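(* Let $d\ge3$. Then there exist a function $v\in\mathcal S(\mathbb R^d)$ and a potential $W(x)\in\mathcal S(\mathbb R^d)$ such that $$\Delta^2v-v+W(x)v=0.$$ The potential has the following explicit representation in terms of the solution $v$: $$W(x)=-5v^8+24v^6-33v^4+12v^2-20v^2|\nabla v|^2+18|\nabla v|^2.$$
   Context: $\mathcal S(\mathbb R^d)$ is the Schwartz class, $\Delta$ the Laplacian on $\mathbb R^d$, $\Delta^2v=\Delta(\Delta v)$, and $\nabla v$ is the gradient of $v$. *)

(* Defs.v *)
From HB Require Import structures.
From mathcomp Require Import all_boot all_order all_algebra.
From mathcomp Require Import all_classical all_reals all_analysis.
Import Order.TTheory GRing.Theory Num.Theory.
Import numFieldNormedType.Exports.

Set Implicit Arguments.
Unset Strict Implicit.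
Unset Printing Implicit Defensive.

Local Open Scope ring_scope.

Definition basis_vec (R : realType) (d : nat) (i : 'I_d) : 'rV[R]_d :=
  delta_mx 0 i.

Definition partial (R : realType) (d : nat) (i : 'I_d)
    (f : 'rV[R]_d -> R) : 'rV[R]_d -> R :=
  'D_(basis_vec R i) f.

(* [partials [:: i1; ...; ik] f] is the k-th order derivative
   d_{i1} (... (d_{ik} f)); ranging over words rather than multi-indices
   includes every order of differentiation. *)
Definition partials (R : realType) (d : nat) (s : seq 'I_d)
    (f : 'rV[R]_d -> R) : 'rV[R]_d -> R :=
  foldr (@partial R d) f s.

(* ['D_v f] is a total operator, so existence of each partial derivative
   has to be required separately from its continuity. *)
Definition smooth (R : realType) (d : nat) (f : 'rV[R]_d -> R) : Prop :=
  forall s : seq 'I_d,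
    continuous (partials s f) /\
    forall (i : 'I_d) (x : 'rV[R]_d), derivable (partials s f) x (basis_vec R i).

Definition monomial (R : realType) (d : nat) (alpha : 'I_d -> nat)
    (x : 'rV[R]_d) : R :=
  \prod_(i < d) x 0 i ^+ alpha i.

Definition schwartz (R : realType) (d : nat) (f : 'rV[R]_d -> R) : Prop :=
  smooth f /\
  forall (alpha : 'I_d -> nat) (s : seq 'I_d),
    exists M : R, forall x : 'rV[R]_d,
      `| monomial alpha x * partials s f x | <= M.

Definition laplacian (R : realType) (d : nat) (f : 'rV[R]_d -> R) :
    'rV[R]_d -> R :=
  fun x => \sum_(i < d) partial i (partial i f) x.

Definition gradient (R : realType) (d : nat) (f : 'rV[R]_d -> R)
    (x : 'rV[R]_d) : 'rV[R]_d :=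
  \row_(i < d) partial i f x.

(* The library norm on ['rV[R]_d] is the sup norm. *)
Definition enorm (R : realType) (d : nat) (u : 'rV[R]_d) : R :=
  Num.sqrt (\sum_(i < d) u 0 i ^+ 2).

(* Main.v *)
Require Import Defs.
From mathcomp Require Import all_boot all_order all_algebra.
From mathcomp Require Import all_classical all_reals all_analysis.
From mathcomp Require Import ring lra.
Import Order.TTheory GRing.Theory Num.Theory.
Import numFieldNormedType.Exports.
Local Open Scope classical_set_scope.
Local Open Scope ring_scope.

Set Implicit Arguments.
Unset Strict Implicit.
Unset Printing Implicit Defensive.

(** If [Delta v = f v] with [f u = u - 3 u ^ 3 + u ^ 5], then
    [Delta^2 v = f'' v |grad v| ^ 2 + f' v f v], which is [v - W v] for the
    prescribed [W].  A radial decaying solution [v x = w (|x| ^ 2)] is found by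
    shooting on [a = w 0] in [4/5, phi), where the golden ratio [phi] is the
    largest zero of [f].  In the variable [s = |x| ^ 2] the equation is
    [4 s w'' + 2 d w' = f w]; it is regular at [0] in the integral form
    [w' s = 1/2 int_0^1 t ^ (d - 1) f (w (t ^ 2 s)) dt], and the energy
    [2 s w' ^ 2 - F w], with [F' = f] and [F 0 = 0], is nonincreasing.  Let [a]
    be the infimum of the heights for which [w] changes sign.  Its profile is
    positive, and its energy is nonnegative as a limit of energies of profiles
    whose zeros escape to infinity; this forces [w' < 0] and exponential decay.
    All derivatives of [w] decay rapidly because [s w''] is a combination of
    [f w] and [w']. *)

(** * Antiderivatives and locally Lipschitz functions *)

Section Calculus.
Context {R : realType}.
Implicit Types (f g h df dg : R -> R) (a b c x y : R).

(** The polynomial [f] is odd with [f' 0 = 1]. Hence [f'' v] and [v - f' v f v] are multiples of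
    [v], and [W] is a polynomial in [v] and [|grad v| ^ 2] without constant term: no division by [v]
    occurs, and [W] is a Schwartz function as soon as [v] is one. Shooting works because [F] is
    positive just above 0 and negative from about 0.90 to beyond [phi]. A profile released near
    [phi] has energy close to [- F phi > 0] and keeps enough of it to pass through 0; one released
    at [4/5] starts with negative energy and never reaches 0. The height [4/5] lies between the
    smallest positive zeros of [f], which is [phi - 1], and of [F]: there [f < 0] makes the profile
    start downwards, while [F > 0] is the energy barrier. The variable [s] runs through all of [R],
    so that derivatives at [s = 0] are two-sided and [v] is smooth at the origin without a parity
    argument. The price is that the profile must be controlled for negative [s] as well. *)

Definition antiderivative f df := forall x, is_derive x 1 f (df x).

Lemma antiderivative_continuous f df : antiderivative f df -> continuous f.
Proof.
move=> fdf x; apply: differentiable_continuous.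
by apply/derivable1_diffP; case: (fdf x).
Qed.

Lemma antiderivative_MVT f df a b : antiderivative f df -> a < b ->
  exists2 c, a < c < b & f b - f a = df c * (b - a).
Proof.
move=> fdf ab.
have [|c cab ->] := MVT ab (fun x _ => fdf x).
  exact/continuous_subspaceT/antiderivative_continuous/fdf.
by exists c => //; move: cab; rewrite in_itv.
Qed.

Lemma antiderivative_le f df a b : antiderivative f df -> a <= b ->
  (forall x, a < x < b -> 0 <= df x) -> f a <= f b.
Proof.
move=> fdf; rewrite le_eqVlt => /predU1P[->//|ab] df0.
have [c cab fab] := antiderivative_MVT fdf ab.
rewrite -subr_ge0 fab mulr_ge0 ?df0//; lra.
Qed.

Lemma antiderivative_ge f df a b : antiderivative f df -> a <= b ->
  (forall x, a < x < b -> df x <= 0) -> f b <= f a.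
Proof.
move=> fdf; rewrite le_eqVlt => /predU1P[->//|ab] df0.
have [c cab fab] := antiderivative_MVT fdf ab.
rewrite -subr_le0 fab mulr_le0_ge0 ?df0//; lra.
Qed.

Lemma antiderivative_cst0 f a b : antiderivative f (fun=> 0) -> f a = f b.
Proof. by move=> f0; apply: is_derive_0_is_cst => x; exact: f0. Qed.

Lemma antiderivative_comp f g df dg : antiderivative f df ->
  antiderivative g dg ->
  antiderivative (f \o g) (fun x => df (g x) * dg x).
Proof.
by move=> fd gd x; have ? := gd x; have ? := fd (g x); apply: is_derive1_comp.
Qed.

Lemma antiderivative_exists q : continuous q ->
  exists Q, antiderivative Q q /\ Q 0 = 0.
Proof.
move=> qc.
pose mu := @lebesgue_measure R.
pose I a x : R := (\int[mu]_(t in `[a, x]) q t)%R.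
pose J x : R := if 0 <= x then (\int[mu]_(t in `]0%R, x]) q t)%R
                else - (\int[mu]_(t in `]x, 0%R]) q t)%R.
have qi a b : mu.-integrable `[a, b] (EFin \o q).
  apply: continuous_compact_integrable; first exact: segment_compact.
  exact: continuous_subspaceT.
have Id a x : a < x -> is_derive x 1 (I a) (q x).
  move=> ax; have xx : x < x + 1 by rewrite ltrDl.
  have [D1 D2] := continuous_FTC1_closed xx (qi _ _) ax (qc x).
  apply: DeriveDef; [exact: D1|rewrite -derive1E; exact: D2].
have JE a x : a < x -> a < 0 -> J x = I a x - I a 0.
  move=> ax a0; rewrite /J /I; case: ifPn => x0.
    by rewrite Rintegral_itvB// ?bnd_simp// ltW.
  rewrite -opprB Rintegral_itvB// ?bnd_simp// ?ltW//.
  by rewrite ltNge.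
exists J; split; last first.
  by rewrite (JE (- 1)) ?subrr// oppr_lt0.
(* This base point lies to the left of both [x] and [0], so that near [x] both branches of [J] equal
   [I a] up to one constant. *)
move=> x; pose a := - `|x| - 1.
have ax : a < x by rewrite /a ltrBlDr ltr_pwDr// lerNl ler_normr lexx orbT.
have a0 : a < 0 by rewrite /a -opprD oppr_lt0 ltr_pwDr.
apply: (@near_eq_is_derive _ _ _ (fun y => I a y - I a 0)).
- near=> y; apply/esym/JE => //.
  by near: y; exact: lt_nbhsr.
- have := Id a x ax => ?.
  by apply: is_derive_eq; rewrite subr0.
Unshelve. all: by end_near. Qed.

Lemma antiderivative_ext f df dg : antiderivative f df -> df =1 dg ->
  antiderivative f dg.
Proof. by move=> fd /funext <-. Qed.

Lemma antiderivativeD f g df dg : antiderivative f df -> antiderivative g dg ->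
  antiderivative (fun x => f x + g x) (fun x => df x + dg x).
Proof. by move=> fd gd x; have := fd x; have := gd x => ? ?; exact: is_deriveD. Qed.

Lemma antiderivativeB f g df dg : antiderivative f df -> antiderivative g dg ->
  antiderivative (fun x => f x - g x) (fun x => df x - dg x).
Proof. by move=> fd gd x; have := fd x; have := gd x => ? ?; exact: is_deriveB. Qed.

Lemma antiderivativeZ k f df : antiderivative f df ->
  antiderivative (fun x => k * f x) (fun x => k * df x).
Proof. by move=> fd x; have := fd x => ?; exact: is_deriveZ. Qed.

Lemma antiderivativeM f g df dg : antiderivative f df -> antiderivative g dg ->
  antiderivative (fun x => f x * g x) (fun x => df x * g x + f x * dg x).
Proof.
move=> fd gd x; have := fd x; have := gd x => ? ?.
by apply: is_derive_eq; rewrite /GRing.scale /=; ring.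
Qed.

Lemma antiderivative_cst k : antiderivative (fun=> k) (fun=> 0).
Proof. by move=> x; exact: is_derive_cst. Qed.

Lemma antiderivative_id : antiderivative id (fun=> 1).
Proof. by move=> x; exact: is_derive_id. Qed.

Lemma antiderivativeX n : antiderivative (fun x => x ^+ n.+1)
  (fun x => n.+1%:R * x ^+ n).
Proof.
elim: n => [|n IH].
  by apply: antiderivative_ext antiderivative_id _ => x; rewrite mulr1.
rewrite [X in antiderivative X](_ : _ = fun x => x * x ^+ n.+1); last first.
  by apply/funext => x; rewrite exprS.
apply: antiderivative_ext (antiderivativeM antiderivative_id IH) _ => x.
by rewrite -(natr1 n.+1) exprS; ring.
Qed.

(** Choosing an antiderivative, instead of writing an integral, reduces computations to uniqueness:
    any explicit antiderivative evaluates it through [primitiveE]. *)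
Definition primitive q := xget (fun=> 0) [set Q | antiderivative Q q /\ Q 0 = 0].

Lemma primitiveP q : continuous q ->
  antiderivative (primitive q) q /\ primitive q 0 = 0.
Proof.
move=> /antiderivative_exists[Q HQ]; rewrite /primitive.
by case: xgetP => [P _ //|/(_ Q)].
Qed.

Lemma primitiveE Q q x : antiderivative Q q -> continuous q ->
  primitive q x = Q x - Q 0.
Proof.
move=> Qq /primitiveP[Pq P0].
have D := antiderivativeB Qq Pq.
have /(@antiderivative_cst0 _ x 0) : antiderivative (fun x => Q x - primitive q x) (fun=> 0).
  by apply: antiderivative_ext D _ => y; rewrite subrr.
by rewrite P0; lra.
Qed.

(** Takes the place of continuity: it is stable under products and composition, and its constants,
    uniform on balls, allow differentiation under the integral by plain estimates. *)
Definition locally_lipschitz h := forall S : R, exists2 K, 0 <= K &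
  forall x y, `|x| <= S -> `|y| <= S -> `|h x - h y| <= K * `|x - y|.

Lemma locally_lipschitz_continuous h : locally_lipschitz h -> continuous h.
Proof.
move=> hl x; have [K K0 hK] := hl (`|x| + 1).
apply/cvgrPdist_le => e e0; near=> y.
have yx : `|x - y| <= 1.
  by near: y; apply: cvgr_dist_le; [exact: cvg_id|rewrite ltr01].
have ye : `|x - y| <= e / (K + 1).
  by near: y; apply: cvgr_dist_le; [exact: cvg_id|rewrite divr_gt0// ltr_wpDl].
apply: le_trans (hK _ _ _ _) _; first by rewrite lerDl.
  by rewrite -[y in `|y|](subKr x) (le_trans (ler_normB _ _))// lerD2l.
apply: le_trans (ler_wpM2l K0 ye) _.
rewrite mulrCA ger_pMr// ler_pdivrMr ?ltr_wpDl//; lra.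
Unshelve. all: by end_near. Qed.

Lemma locally_lipschitz_bounded h : locally_lipschitz h ->
  forall S : R, exists2 M, 0 <= M & forall x, `|x| <= S -> `|h x| <= M.
Proof.
move=> hl S; have [K K0 hK] := hl S.
exists (`|h 0| + K * `|S|); first by rewrite addr_ge0// mulr_ge0.
move=> x xS; have S0 : 0 <= S := le_trans (normr_ge0 _) xS.
rewrite -[h x](subrK (h 0)) addrC; apply: le_trans (ler_normD _ _) _.
rewrite lerD2l; apply: le_trans (hK _ _ _ _) _; rewrite ?normr0//.
by rewrite subr0 ler_wpM2l// (ger0_norm S0).
Qed.

Lemma locally_lipschitzD h g : locally_lipschitz h -> locally_lipschitz g ->
  locally_lipschitz (fun x => h x + g x).
Proof.
move=> hl gl S; have [K K0 hK] := hl S; have [L L0 gL] := gl S.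
exists (K + L) => [|x y xS yS]; first exact: addr_ge0.
rewrite opprD addrACA mulrDl; apply: le_trans (ler_normD _ _) _.
by apply: lerD; [exact: hK|exact: gL].
Qed.

Lemma locally_lipschitzM h g : locally_lipschitz h -> locally_lipschitz g ->
  locally_lipschitz (fun x => h x * g x).
Proof.
move=> hl gl S; have [K K0 hK] := hl S; have [L L0 gL] := gl S.
have [M M0 hM] := locally_lipschitz_bounded hl S.
have [N N0 gN] := locally_lipschitz_bounded gl S.
exists (M * L + K * N) => [|x y xS yS]; first by rewrite addr_ge0// mulr_ge0.
have -> : h x * g x - h y * g y = h x * (g x - g y) + (h x - h y) * g y by ring.
apply: le_trans (ler_normD _ _) _; rewrite [leRHS]mulrDl !normrM lerD//.
  by rewrite -mulrA ler_pM// ?hM ?gL.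
by rewrite mulrAC ler_pM// ?gN ?hK.
Qed.

Lemma locally_lipschitz_cst k : locally_lipschitz (fun=> k).
Proof. by move=> S; exists 0 => // x y _ _; rewrite subrr normr0 mul0r. Qed.

Lemma locally_lipschitz_id : locally_lipschitz id.
Proof. by move=> S; exists 1 => // x y _ _; rewrite mul1r. Qed.

Lemma locally_lipschitzZ k h : locally_lipschitz h ->
  locally_lipschitz (fun x => k * h x).
Proof. exact/locally_lipschitzM/locally_lipschitz_cst. Qed.

Lemma locally_lipschitz_comp h g : locally_lipschitz h -> locally_lipschitz g ->
  locally_lipschitz (fun x => h (g x)).
Proof.
move=> hl gl S; have [L L0 gL] := gl S.
have [N N0 gN] := locally_lipschitz_bounded gl S.
have [K K0 hK] := hl N.
exists (K * L) => [|x y xS yS]; first exact: mulr_ge0.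
by rewrite (le_trans (hK _ _ (gN _ xS) (gN _ yS)))// -mulrA ler_wpM2l// gL.
Qed.

Lemma antiderivative_lip f df K S : antiderivative f df ->
  (forall x, `|x| <= S -> `|df x| <= K) ->
  forall x y, `|x| <= S -> `|y| <= S -> `|f x - f y| <= K * `|x - y|.
Proof.
move=> fd dK x y.
wlog xy : x y / y < x => [H xS yS|].
  have [yx|xy|->] := ltgtP y x; first exact: H.
  - by rewrite distrC (distrC x); exact: H.
  - by rewrite !subrr normr0 mulr0.
move=> xS yS; have [c /andP[yc cx] ->] := antiderivative_MVT fd xy.
rewrite normrM ler_wpM2r// dK// ler_norml.
move: xS yS; rewrite !ler_norml => /andP[? ?] /andP[? ?].
by rewrite (le_trans _ (ltW yc))// (le_trans (ltW cx)).
Qed.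

Lemma antiderivative_locally_lipschitz f df : antiderivative f df ->
  locally_lipschitz df -> locally_lipschitz f.
Proof.
move=> fd dl S; have [M M0 dM] := locally_lipschitz_bounded dl S.
by exists M => // x y xS yS; exact: (antiderivative_lip fd dM).
Qed.
End Calculus.

(** * Weighted averages *)

Section RadialAverage.
Context {R : realType}.
Implicit Types (f g h q : R -> R) (a b c s x y t k : R) (m n : nat).

Lemma primitiveB q1 q2 x : continuous q1 -> continuous q2 ->
  primitive (fun t => q1 t - q2 t) x = primitive q1 x - primitive q2 x.
Proof.
move=> c1 c2; have [d1 z1] := primitiveP c1; have [d2 z2] := primitiveP c2.
have c12 : continuous (fun t => q1 t - q2 t).
  by move=> z; apply: cvgB; [exact: c1|exact: c2].
by rewrite (primitiveE _ (antiderivativeB d1 d2) c12) z1 z2 subr0 subr0.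
Qed.

Lemma primitiveZ k q x : continuous q ->
  primitive (fun t => k * q t) x = k * primitive q x.
Proof.
move=> c1; have [d1 z1] := primitiveP c1.
have c12 : continuous (fun t => k * q t).
  by move=> z; apply: cvgM; [exact: cvg_cst|exact: c1].
by rewrite (primitiveE _ (antiderivativeZ k d1) c12) z1 mulr0 subr0.
Qed.

Lemma primitive_le q1 q2 x : continuous q1 -> continuous q2 -> 0 <= x ->
  (forall t, 0 < t < x -> q1 t <= q2 t) -> primitive q1 x <= primitive q2 x.
Proof.
move=> c1 c2 x0 q12; have [d1 z1] := primitiveP c1; have [d2 z2] := primitiveP c2.
have := antiderivative_le (antiderivativeB d2 d1) x0.
by rewrite z1 z2 subr0 subr_ge0; apply => t /q12; rewrite subr_ge0.
Qed.

Lemma primitive_expr n x :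
  primitive (fun t => t ^+ n) x = x ^+ n.+1 / n.+1%:R :> R.
Proof.
have c : continuous (fun t : R => t ^+ n) by move=> z; exact: exprn_continuous.
have D := antiderivativeZ (n.+1%:R^-1) (@antiderivativeX R n).
have E : antiderivative (fun x : R => n.+1%:R^-1 * x ^+ n.+1) (fun x => x ^+ n).
  by apply: antiderivative_ext D _ => y; rewrite mulKf// pnatr_eq0.
by rewrite (primitiveE _ E c) expr0n/= mulr0 subr0 mulrC.
Qed.

(* [avg m h s] is the integral of [t ^ m * h (t ^ 2 * s)] over [0, 1]. *)
Definition avg m h s := primitive (fun t => t ^+ m * h (t ^+ 2 * s)) 1.

Lemma avg_integrand_continuous m h s : continuous h ->
  continuous (fun t => t ^+ m * h (t ^+ 2 * s)).
Proof.
move=> hc t; apply: cvgM; first exact: exprn_continuous.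
apply: (@continuous_comp _ _ _ (fun t => t ^+ 2 * s) h); last exact: hc.
by apply: cvgM; [exact: exprn_continuous|exact: cvg_cst].
Qed.

Lemma avgB m g h s : continuous g -> continuous h ->
  avg m (fun t => g t - h t) s = avg m g s - avg m h s.
Proof.
move=> gc hc; rewrite /avg -primitiveB; [|exact: avg_integrand_continuous..].
by congr (primitive _ 1); apply/funext => t; rewrite mulrBr.
Qed.

Lemma avgZ m k h s : continuous h ->
  avg m (fun t => k * h t) s = k * avg m h s.
Proof.
move=> hc; rewrite /avg -primitiveZ; last exact: avg_integrand_continuous.
by congr (primitive _ 1); apply/funext => t; rewrite mulrCA.
Qed.

Lemma avg_le m g h s : continuous g -> continuous h ->
  (forall t, 0 <= t <= 1 -> g (t * s) <= h (t * s)) -> avg m g s <= avg m h s.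
Proof.
move=> gc hc gh; apply: primitive_le => //; try exact: avg_integrand_continuous.
move=> t /andP[/ltW t0 /ltW t1]; apply: ler_wpM2l; first exact: exprn_ge0.
by apply: gh; rewrite exprn_ge0 ?exprn_ile1.
Qed.

Lemma avg_cst m c s : avg m (fun=> c) s = c / m.+1%:R.
Proof.
have H : avg m (fun=> c * 1) s = c / m.+1%:R.
  rewrite avgZ; last by move=> ?; exact: cvg_cst.
  rewrite /avg -[X in c * X]/(primitive _ _).
  under eq_fun do rewrite mulr1.
  by rewrite primitive_expr expr1n mul1r.
by rewrite -H; congr (avg m _ s); apply/funext => ?; rewrite mulr1.
Qed.

Lemma avg_ub m h c s : continuous h ->
  (forall t, 0 <= t <= 1 -> h (t * s) <= c) -> avg m h s <= c / m.+1%:R.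
Proof.
by move=> hc H; rewrite -(avg_cst m c s) avg_le// => ?; exact: cvg_cst.
Qed.

Lemma avg_norm m h c s : continuous h ->
  (forall t, 0 <= t <= 1 -> `|h (t * s)| <= c) -> `|avg m h s| <= c.
Proof.
move=> hc H.
have c0 : 0 <= c by apply: le_trans (H 0 _); rewrite ?normr_ge0// lexx ler01.
apply: (@le_trans _ _ (c / m.+1%:R)); last first.
  by rewrite ler_pdivrMr ?ltr0n// ler_peMr// ler1n.
rewrite ler_norml -mulNr -!(avg_cst m _ s); apply/andP; split.
- by apply: avg_le => // [?|t /H]; [exact: cvg_cst|rewrite ler_norml => /andP[]].
- by apply: avg_le => // [?|t /H]; [exact: cvg_cst|rewrite ler_norml => /andP[]].
Qed.

Lemma norm_unit_scale t s : 0 <= t <= 1 -> `|t * s| <= `|s|.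
Proof.
move=> /andP[t0 t1]; rewrite normrM (ger0_norm t0).
by rewrite ler_piMl.
Qed.

(** The bound makes the difference quotient, completed by [l] at [x], continuous there. A remainder
    estimate can be averaged over a parameter, whereas averaging a limit would need an interchange
    theorem. *)
Lemma is_derive_quadratic f x l K :
  (forall y, `|y - x| <= 1 -> `|f y - f x - l * (y - x)| <= K * `|y - x| ^+ 2) ->
  is_derive x 1 f l.
Proof.
move=> H; apply/is_derive1_caratheodory.
pose g y := if y == x then l else (f y - f x) / (y - x).
exists g; split; last 1 first.
  by rewrite /g eqxx.
  move=> y; rewrite /g; case: eqVneq => [->|yx]; first by rewrite !subrr mulr0.
  by rewrite mulfVK// subr_eq0.
have K0 : 0 <= K.
  have := H (x + 1); rewrite [x + 1 - x]addrAC subrr add0r normr1 expr1n mulr1 mulr1.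
  by move=> /(_ (lexx _)); apply: le_trans; exact: normr_ge0.
apply/cvgrPdist_le => e e0; near=> y.
have yx : `|x - y| <= 1.
  by near: y; apply: cvgr_dist_le; [exact: cvg_id|rewrite ltr01].
have ye : `|x - y| <= e / (K + 1).
  by near: y; apply: cvgr_dist_le; [exact: cvg_id|rewrite divr_gt0// ltr_wpDl].
rewrite /g eqxx; case: eqVneq => [_|nyx]; first by rewrite subrr normr0 ltW.
have n0 : y - x != 0 by rewrite subr_eq0.
have -> : l - (f y - f x) / (y - x) = - (f y - f x - l * (y - x)) / (y - x).
  by field.
rewrite normrM normrN normfV ler_pdivrMr ?normr_gt0//.
apply: le_trans (H _ _) _; first by rewrite distrC.
rewrite expr2 mulrA ler_wpM2r// distrC.
apply: le_trans (ler_wpM2l K0 ye) _.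
rewrite mulrCA ger_pMr// ler_pdivrMr ?ltr_wpDl//; lra.
Unshelve. all: by end_near. Qed.

(** The mean value theorem for [h] minus its tangent at [x] leaves an increment of [h1] times
    [y - x], and each factor is of order [y - x]. *)
Lemma antiderivative_taylor1 h h1 : antiderivative h h1 -> locally_lipschitz h1 ->
  forall S : R, exists2 K, 0 <= K & forall x y, `|x| <= S -> `|y| <= S ->
    `|h y - h x - h1 x * (y - x)| <= K * `|y - x| ^+ 2.
Proof.
move=> hd hl S; have [K K0 hK] := hl S; exists K => // x y xS yS.
have D := antiderivativeB hd (antiderivativeZ (h1 x) (@antiderivative_id R)).
have -> : h y - h x - h1 x * (y - x) = h y - h1 x * y - (h x - h1 x * x) by ring.
have H c : `|c| <= S -> `|c - x| <= `|y - x| ->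
    `|(h1 c - h1 x * 1) * (y - x)| <= K * `|y - x| ^+ 2.
  move=> cS cx; rewrite mulr1 normrM expr2 mulrA ler_wpM2r//.
  by apply: le_trans (hK _ _ cS xS) _; exact: ler_wpM2l.
have SS : - S <= x <= S /\ - S <= y <= S by rewrite -!ler_norml.
have [xy|yx|->] := ltgtP x y; last by rewrite !subrr normr0 expr0n mulr0.
- have [c cxy ->] := antiderivative_MVT D xy; apply: H; first by rewrite ler_norml; lra.
  by rewrite !ger0_norm; lra.
- have [c cxy E] := antiderivative_MVT D yx.
  rewrite distrC E -(opprB y x) mulrN normrN; apply: H; first by rewrite ler_norml; lra.
  by rewrite !ler0_norm; lra.
Qed.

(** With the parameter moved into the function, averages at different points become averages at 1
    and can be subtracted. *)
Lemma avg_shift1 m h s : avg m h s = avg m (fun y => h (y * s)) 1.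
Proof. by rewrite /avg; under [in RHS]eq_fun do rewrite mulr1. Qed.

Lemma continuous_scale h s : continuous h -> continuous (fun y => h (y * s)).
Proof.
move=> hc y; apply: (@continuous_comp _ _ _ (fun y => y * s) h); last exact: hc.
by apply: cvgM; [exact: cvg_id|exact: cvg_cst].
Qed.

Lemma avg_locally_lipschitz m h : locally_lipschitz h ->
  locally_lipschitz (avg m h).
Proof.
move=> hl S; have [K K0 hK] := hl S; exists K => // x y xS yS.
have hc := locally_lipschitz_continuous hl.
rewrite (avg_shift1 m h x) (avg_shift1 m h y) -avgB; try exact: continuous_scale.
apply: avg_norm => [|t t01].
  by move=> z; apply: cvgB; exact: continuous_scale.
rewrite mulr1; apply: le_trans (hK _ _ _ _) _.
- exact: le_trans (norm_unit_scale _ t01) xS.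
- exact: le_trans (norm_unit_scale _ t01) yS.
- by rewrite -mulrBr ler_wpM2l// norm_unit_scale.
Qed.

(** Differentiating [h (t ^ 2 * s)] in [s] brings out [t ^ 2], which raises the weight by two. The
    Taylor remainder is quadratic uniformly in [t], hence so is its average. *)
Lemma avg_antiderivative m h h1 : antiderivative h h1 -> locally_lipschitz h1 ->
  antiderivative (avg m h) (avg m.+2 h1).
Proof.
move=> hd h1l x.
have [K K0 hK] := antiderivative_taylor1 hd h1l (`|x| + 1).
have hc := antiderivative_continuous hd.
have h1c := locally_lipschitz_continuous h1l.
apply: (@is_derive_quadratic _ _ _ K) => y yx.
have yS : `|y| <= `|x| + 1.
  by rewrite -[y](subrK x) addrC (le_trans (ler_normD _ _))// lerD2l.
have xS : `|x| <= `|x| + 1 by rewrite lerDl.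
have c1 : continuous (fun z : R => z * h1 (z * x)).
  by move=> z; apply: cvgM; [exact: cvg_id|exact: continuous_scale].
have -> : avg m.+2 h1 x = avg m (fun z => z * h1 (z * x)) 1.
  rewrite /avg; congr (primitive _ 1); apply/funext => t.
  by rewrite mulr1 -addn2 exprD mulrA.
rewrite mulrC -avgZ// (avg_shift1 m h x) (avg_shift1 m h y) -!avgB; try exact: continuous_scale.
- apply: avg_norm => [z|t t01].
    apply: cvgB; first by apply: cvgB; exact: continuous_scale.
    by apply: cvgM; [exact: cvg_cst|exact: c1].
  rewrite mulr1.
  have -> : (y - x) * (t * h1 (t * x)) = h1 (t * x) * (t * y - t * x) by ring.
  apply: le_trans (hK _ _ _ _) _.
  + exact: le_trans (norm_unit_scale _ t01) xS.
  + exact: le_trans (norm_unit_scale _ t01) yS.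
  + rewrite -mulrBr ler_wpM2l// lerXn2r ?nnegrE ?normr_ge0//.
    exact: norm_unit_scale.
- by move=> z; apply: cvgB; exact: continuous_scale.
- by move=> z; apply: cvgM; [exact: cvg_cst|exact: c1].
Qed.

(* Integration by parts: [t ^ m.+1 * h (t ^ 2 * s)] is differentiated in [t]. *)
Lemma avg_parts m h h1 s : antiderivative h h1 -> locally_lipschitz h1 ->
  2 * s * avg m.+2 h1 s + m.+1%:R * avg m h s = h s.
Proof.
move=> hd h1l.
have hc := antiderivative_continuous hd.
have h1c := locally_lipschitz_continuous h1l.
pose q t := 2 * s * (t ^+ m.+2 * h1 (t ^+ 2 * s)).
pose q' t := - m.+1%:R * (t ^+ m * h (t ^+ 2 * s)).
have ic n g : continuous g -> continuous (fun t => t ^+ n * g (t ^+ 2 * s)).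
  exact: avg_integrand_continuous.
have qc : continuous q.
  by move=> z; apply: cvgM; [exact: cvg_cst|exact: ic].
have q'c : continuous q'.
  by move=> z; apply: cvgM; [exact: cvg_cst|exact: ic].
have -> : 2 * s * avg m.+2 h1 s + m.+1%:R * avg m h s =
    primitive (fun t => q t - q' t) 1.
  rewrite primitiveB// primitiveZ; last exact: ic.
  by rewrite primitiveZ; [rewrite mulNr opprK|exact: ic].
have D2 : antiderivative (fun t => t ^+ 2 * s) (fun t => 2 * s * t).
  have D := antiderivativeZ s (@antiderivativeX R 1).
  rewrite (_ : (fun t => _) = (fun t => s * t ^+ 2)); last first.
    by apply/funext => t; rewrite mulrC.
  by apply: antiderivative_ext D _ => t; rewrite expr1; ring.
have D := antiderivativeM (@antiderivativeX R m) (antiderivative_comp hd D2).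
rewrite (primitiveE _ (Q := fun t => t ^+ m.+1 * h (t ^+ 2 * s))).
- by rewrite !expr1n !mul1r expr0n/= mul0r subr0.
- apply: antiderivative_ext D _ => t; rewrite /q /q' /comp.
  by rewrite [t ^+ m.+2]exprS [t ^+ m.+1]exprS; ring.
- by move=> z; apply: cvgB; [exact: qc|exact: q'c].
Qed.
End RadialAverage.

(** * Picard iteration *)

Section Picard.
Context {R : realType}.
Implicit Types (f g h w z D d : R -> R) (a b c s x y t C : R) (k : nat).

(** The intervals around [u k] whose radius is the geometric tail are nested, and the supremum of
    their left ends lies in all of them. The explicit rate lets later estimates pass to the limit
    through [le_of_geometric]. *)
Lemma geometric_limit (u : nat -> R) C :
  (forall k, `|u k.+1 - u k| <= C * 2^-1 ^+ k) ->
  exists l, forall k, `|u k - l| <= 2 * C * 2^-1 ^+ k.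
Proof.
move=> uC; pose e k := 2 * C * 2^-1 ^+ k : R.
have eS k : e k - e k.+1 = C * 2^-1 ^+ k by rewrite /e exprS; lra.
have ub k : u k - e k <= u k.+1 - e k.+1 /\ u k.+1 + e k.+1 <= u k + e k.
  by have := uC k; have := eS k; rewrite ler_norml => ? /andP[? ?]; lra.
have e0 k : 0 <= e k.
  rewrite /e mulr_ge0 ?exprn_ge0 ?invr_ge0// mulr_ge0//.
  by have := le_trans (normr_ge0 _) (uC 0); rewrite expr0 mulr1.
have lo : nondecreasing_seq (fun k => u k - e k).
  by apply/nondecreasing_seqP => k; case: (ub k).
have hi : nonincreasing_seq (fun k => u k + e k).
  by apply/nonincreasing_seqP => k; case: (ub k).
have lohi j k : u j - e j <= u k + e k.
  have := lo j (maxn j k) (leq_maxl _ _); have := hi k (maxn j k) (leq_maxr _ _).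
  by rewrite /=; have := e0 (maxn j k); lra.
pose A := range (fun k => u k - e k).
have Asup : has_sup A.
  split; first by exists (u 0%N - e 0%N), 0%N.
  by exists (u 0%N + e 0%N) => _ [k _ <-].
exists (sup A) => k; rewrite distrC ler_distl; apply/andP; split.
  by apply: sup_upper_bound => //; exists k.
apply: ge_sup; first by case: Asup.
by move=> _ [j _ <-].
Qed.

Lemma le_of_geometric x y C : (forall k, x <= y + C * 2^-1 ^+ k) -> x <= y.
Proof.
move=> H; apply/ler_addgt0Pl => e e0.
have [k Hk] : exists k : nat, C * 2^-1 ^+ k <= e.
  have [C0|C0] := leP C 0.
    by exists 0%N; rewrite expr0 mulr1 (le_trans C0)// ltW.
  have Ce : 0 <= C / e by rewrite divr_ge0// ltW.
  exists (Num.bound (C / e)).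
  have B := archi_boundP Ce.
  rewrite exprVn ler_pdivrMr ?exprn_gt0// -ler_pdivrMl// mulrC.
  apply: le_trans (ltW B) _; rewrite -natrX ler_nat.
  exact/ltnW/ltn_expl.
by rewrite addrC; apply: le_trans (H k) _; rewrite lerD2l.
Qed.

(** Integrating the weight [expR (L * t)] gains a factor [1 / L]. Measured against this weight
    (Bielecki's norm), the Picard map contracts on the whole line at once, and no continuation of
    local solutions is needed. *)
Lemma exp_majorant_pos (L C : R) D d s : 0 < L -> 0 <= C ->
  antiderivative D d -> D 0 = 0 -> 0 <= s ->
  (forall t, 0 < t < s -> d t <= C * expR (L * t)) ->
  D s <= C / L * expR (L * s).
Proof.
move=> L0 C0 Dd D0 s0 H.
have LD : antiderivative (fun x => L * x) (fun=> L).
  by apply: antiderivative_ext (antiderivativeZ L (@antiderivative_id R)) _ => x; rewrite mulr1.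
have Ed := antiderivativeZ (C / L)
  (antiderivative_comp (fun x => is_derive_expR x) LD).
have := antiderivative_le (antiderivativeB Ed Dd) s0.
rewrite D0 /comp mulr0 expR0 subr0 mulr1 => /(_ _).
have CL : 0 <= C / L by rewrite divr_ge0// ltW.
suff H' : forall t, 0 < t < s -> 0 <= C / L * (expR (L * t) * L) - d t.
  by move=> /(_ H'); lra.
move=> t /H Ht; rewrite subr_ge0 (le_trans Ht)//.
by rewrite mulrCA divfK ?gt_eqF// mulrC.
Qed.

Lemma exp_majorant (L C : R) D d : 0 < L -> antiderivative D d -> D 0 = 0 ->
  (forall t, `|d t| <= C * expR (L * `|t|)) ->
  forall s, `|D s| <= C / L * expR (L * `|s|).
Proof.
move=> L0 Dd D0 H s.
have C0 : 0 <= C.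
  by have := le_trans (normr_ge0 _) (H 0); rewrite normr0 mulr0 expR0 mulr1.
have DN : antiderivative (fun x => - D x) (fun x => - d x).
  by move=> x; have := Dd x => ?; exact: is_deriveN.
have ND : antiderivative (fun x : R => - x) (fun=> -1).
  by move=> x; exact: is_deriveNid.
have key (D' d' : R -> R) : antiderivative D' d' -> D' 0 = 0 ->
    (forall t, `|d' t| <= C * expR (L * `|t|)) ->
    0 <= s -> D' s <= C / L * expR (L * s).
  move=> D'd D'0 H' s0; apply: exp_majorant_pos D'd _ _ _ => // t /andP[t0 _].
  by apply: le_trans (ler_norm _) (le_trans (H' _) _); rewrite gtr0_norm.
have [s0|s0] := leP 0 s.
  rewrite (ger0_norm s0) ler_norml lerNl; apply/andP; split.
    by apply: (key (fun x => - D x)) DN _ _ _; rewrite ?D0 ?oppr0// => t; rewrite normrN.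
  exact: key Dd _ _ _.
have key' (D' d' : R -> R) : antiderivative D' d' -> D' 0 = 0 ->
    (forall t, `|d' t| <= C * expR (L * `|t|)) -> D' s <= C / L * expR (L * - s).
  move=> D'd D'0 H'.
  have := exp_majorant_pos L0 C0 (antiderivative_comp D'd ND) _ (_ : 0 <= - s).
  rewrite /comp opprK oppr0 => /(_ D'0); apply; first by rewrite oppr_ge0 ltW.
  move=> t /andP[t0 _]; rewrite mulrN1; apply: le_trans (ler_norm _) _.
  by rewrite normrN (le_trans (H' _))// normrN gtr0_norm.
rewrite (ler0_norm (ltW s0)).
rewrite ler_norml lerNl; apply/andP; split; last exact: key' Dd _ _.
by apply: (key' (fun x => - D x)) DN _ _; rewrite ?D0 ?oppr0// => t; rewrite normrN.
Qed.

Context (m : nat) (F : R -> R) (L : R) (L0 : 0 < L).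

Context (FL : forall x y, `|F x - F y| <= L * `|x - y|).

Let F_lipschitz : locally_lipschitz F.
Proof. by move=> S; exists L => [|x y _ _]; [exact: ltW|exact: FL]. Qed.

(** The radial equation reads [(s^(d/2) w')' = s^(d/2-1) F(w) / 4]. Integrating from 0 and
    substituting [t ^ 2 * s] for the integration variable cancels all powers of [s] and leaves this
    average with [m = d - 1]. *)
Definition half_avg w s := 2^-1 * avg m (fun x => F (w x)) s.

Definition picard_step a w s := a + primitive (half_avg w) s.

Fixpoint picard a k : R -> R :=
  if k is k'.+1 then picard_step a (picard a k') else fun=> a.

Lemma half_avg_lipschitz w : locally_lipschitz w ->
  locally_lipschitz (half_avg w).
Proof.
by move=> wl; apply/locally_lipschitzZ/avg_locally_lipschitz/locally_lipschitz_comp.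
Qed.

Lemma picard_step_antiderivative a w : locally_lipschitz w ->
  antiderivative (picard_step a w) (half_avg w) /\ picard_step a w 0 = a.
Proof.
move=> /half_avg_lipschitz/locally_lipschitz_continuous/primitiveP[D E].
split; last by rewrite /picard_step E addr0.
apply: antiderivative_ext (antiderivativeD (@antiderivative_cst R a) D) _ => s.
by rewrite add0r.
Qed.

Lemma picard_step_lipschitz a w : locally_lipschitz w ->
  locally_lipschitz (picard_step a w).
Proof.
move=> wl; have [D _] := picard_step_antiderivative a wl.
exact: antiderivative_locally_lipschitz D (half_avg_lipschitz wl).
Qed.

Lemma picard_lipschitz a k : locally_lipschitz (picard a k).
Proof.
elim: k => [|k IH]; first exact: locally_lipschitz_cst.
exact: picard_step_lipschitz.
Qed.

Let weight_le s t : 0 <= t <= 1 -> expR (L * `|t * s|) <= expR (L * `|s|).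
Proof.
by move=> t01; rewrite ler_expR (ler_wpM2l (ltW L0))// norm_unit_scale.
Qed.

Let weight_ge1 s : 1 <= expR (L * `|s|).
Proof. by rewrite -expR0 ler_expR mulr_ge0// ltW. Qed.

Lemma half_avg_dist w z C s : locally_lipschitz w -> locally_lipschitz z ->
  (forall t, `|w t - z t| <= C * expR (L * `|t|)) ->
  `|half_avg w s - half_avg z s| <= L * C / 2 * expR (L * `|s|).
Proof.
move=> wl zl H.
have wc := locally_lipschitz_continuous (locally_lipschitz_comp F_lipschitz wl).
have zc := locally_lipschitz_continuous (locally_lipschitz_comp F_lipschitz zl).
have C0 : 0 <= C.
  by have := le_trans (normr_ge0 _) (H 0); rewrite normr0 mulr0 expR0 mulr1.
rewrite /half_avg -mulrBr -avgB// normrM gtr0_norm ?invr_gt0//.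
rewrite mulrC [leRHS]mulrAC ler_wpM2r ?invr_ge0//.
apply: avg_norm => [y|t t01]; first by apply: cvgB; [exact: wc|exact: zc].
apply: le_trans (FL _ _) _; rewrite -mulrA (ler_wpM2l (ltW L0))//.
apply: le_trans (H _) _; rewrite ler_wpM2l//.
exact: weight_le.
Qed.

(** [F] costs a factor [L], integrating the weight returns it, and the half in front of the average
    is the contraction factor. With two heights the same estimate serves convergence, the fixed
    point equation and dependence on the height. *)
Lemma picard_step_dist a b w z C s : locally_lipschitz w -> locally_lipschitz z ->
  (forall t, `|w t - z t| <= C * expR (L * `|t|)) ->
  `|picard_step a w s - picard_step b z s| <=
    `|a - b| + C / 2 * expR (L * `|s|).
Proof.
move=> wl zl H; rewrite /picard_step opprD addrACA.
apply: le_trans (ler_normD _ _) _; rewrite lerD2l.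
have [wD w0] := primitiveP (locally_lipschitz_continuous (half_avg_lipschitz wl)).
have [zD z0] := primitiveP (locally_lipschitz_continuous (half_avg_lipschitz zl)).
have := exp_majorant L0 (antiderivativeB wD zD) _ (fun t => half_avg_dist t wl zl H) s.
rewrite w0 z0 subrr => /(_ erefl) => /le_trans; apply.
rewrite ler_wpM2r ?expR_ge0// (_ : L * C / 2 / L = C / 2)//.
by field; rewrite gt_eqF.
Qed.

Lemma picard_dist_succ a k s :
  `|picard a k.+1 s - picard a k s| <=
    (`|F a| / L * expR (L * `|s|)) * 2^-1 ^+ k.
Proof.
elim: k s => [|k IH] s.
  have [D0 D1] := picard_step_antiderivative a (@locally_lipschitz_cst R a).
  rewrite expr0 mulr1 /=.
  have D := antiderivativeB D0 (@antiderivative_cst R a).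
  apply: (exp_majorant L0 D); first by rewrite D1 subrr.
  move=> t; rewrite subr0 /half_avg avg_cst normrM normrM.
  rewrite mulrCA ler_wpM2l// -normrM; apply: le_trans _ (weight_ge1 _).
  rewrite ger0_norm ?mulr_ge0 ?invr_ge0// mulr_ile1 ?invr_ge0//.
    by rewrite invf_le1 ?ler1n.
  by rewrite invf_le1 ?ler1n ?ltr0n.
have H t : `|picard a k.+1 t - picard a k t| <=
    (`|F a| / L * 2^-1 ^+ k) * expR (L * `|t|).
  by rewrite mulrAC; exact: IH.
have := picard_step_dist a a s (picard_lipschitz a k.+1) (picard_lipschitz a k) H.
rewrite subrr normr0 add0r => /le_trans; apply.
by rewrite exprS -subr_ge0 [X in 0 <= X](_ : _ = 0)//; ring.
Qed.

(** The bound by [|F a|] makes zeros of [F] stationary heights; the Lipschitz dependence on the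
    height drives the shooting. *)
Lemma picard_limit : exists W : R -> R -> R,
  [/\ forall a, locally_lipschitz (W a),
      forall a s, W a s = picard_step a (W a) s,
      forall a s, `|W a s - a| <= 2 * (`|F a| / L * expR (L * `|s|)) &
      forall a b s, `|W a s - W b s| <= 2 * `|a - b| * expR (L * `|s|)].
Proof.
pose B a s := 2 * (`|F a| / L * expR (L * `|s|)).
have H a s : exists l, forall k, `|picard a k s - l| <= B a s * 2^-1 ^+ k.
  exact: geometric_limit (fun k => picard_dist_succ a k s).
have [w Hw] := choice (fun p : R * R => H p.1 p.2).
pose W a s := w (a, s).
have HW a s k : `|picard a k s - W a s| <= B a s * 2^-1 ^+ k := Hw (a, s) k.
rewrite /B in HW; clearbody W; clear B H w Hw.
have W0 a s : `|W a s - a| <= 2 * (`|F a| / L * expR (L * `|s|)).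
  by have := HW a s 0%N; rewrite expr0 mulr1 distrC.
have Wpicard a b s (X := fun k => `|picard a k s - picard b k s|) :
    exists C, forall k, `|W a s - W b s| <= X k + C * 2^-1 ^+ k.
  exists (2 * (`|F a| / L * expR (L * `|s|)) + 2 * (`|F b| / L * expR (L * `|s|))).
  move=> k; have Ha := HW a s k; have Hb := HW b s k; rewrite distrC in Ha.
  rewrite /X mulrDl; set p := picard a k s in Ha *; set q := picard b k s in Hb *.
  have -> : W a s - W b s = (W a s - p) + (p - q) + (q - W b s) by ring.
  by have := ler_normD (W a s - p + (p - q)) (q - W b s);
     have := ler_normD (W a s - p) (p - q); lra.
have Wll a : locally_lipschitz (W a).
  move=> S; pose B := `|F a| / L * expR (L * `|S|).
  have B0 : 0 <= B by rewrite mulr_ge0 ?expR_ge0// divr_ge0// ltW.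
  have monoS s : `|s| <= S -> `|F a| / L * expR (L * `|s|) <= B.
    move=> sS; rewrite /B ler_wpM2l ?divr_ge0 ?(ltW L0)// ler_expR ler_wpM2l ?(ltW L0)//.
    exact: le_trans sS (ler_norm _).
  (* On the ball of radius [S] every iterate stays within [4 * B] of [a], so [K] bounds [F] along it
     and the derivative of the next iterate. This common Lipschitz constant survives in the
     limit. *)
  pose K := `|F a| + L * (4 * B).
  have K0 : 0 <= K by rewrite addr_ge0// mulr_ge0 ?(ltW L0)// mulr_ge0.
  have pB k s : `|s| <= S -> `|picard a k s - a| <= 4 * B.
    move=> sS; have := W0 a s; have := HW a s k; have := monoS s sS => M H1 H2.
    have : 2^-1 ^+ k <= 1 :> R by rewrite exprn_ile1 ?invr_ge0 ?invf_le1 ?ler1n.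
    move=> /(ler_wpM2l (_ : 0 <= 2 * (`|F a| / L * expR (L * `|s|)))) H3.
    have {}H3 := H3 (le_trans (normr_ge0 _) H2).
    have := ler_normD (picard a k s - W a s) (W a s - a).
    by rewrite addrA subrK; lra.
  have pK k x y : `|x| <= S -> `|y| <= S ->
      `|picard a k x - picard a k y| <= K * `|x - y|.
    case: k => [|k] xS yS; first by rewrite subrr normr0 mulr_ge0.
    have [D _] := picard_step_antiderivative a (picard_lipschitz a k).
    apply: (antiderivative_lip D _ xS yS) => t tS.
    rewrite /half_avg normrM ger0_norm ?invr_ge0//.
    apply: (@le_trans _ _ (2^-1 * K)); last first.
      by have := K0; lra.
    rewrite ler_wpM2l ?invr_ge0//; apply: avg_norm.
      exact/locally_lipschitz_continuous/locally_lipschitz_comp/picard_lipschitz/F_lipschitz.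
    move=> r r01; rewrite -[F (picard a k (r * t))](subrK (F a)) addrC.
    apply: le_trans (ler_normD _ _) _; rewrite lerD2l.
    apply: le_trans (FL _ _) _; rewrite ler_wpM2l ?(ltW L0)//.
    exact/pB/(le_trans (norm_unit_scale _ r01)).
  exists K => // x y xS yS; apply: (@le_of_geometric _ _ (4 * B)) => k.
  have := pK k x y xS yS; have := HW a x k; have := HW a y k.
  have e0 : 0 <= 2^-1 ^+ k :> R by rewrite exprn_ge0 ?invr_ge0.
  have := ler_wpM2r e0 (monoS x xS); have := ler_wpM2r e0 (monoS y yS).
  set p := picard a k x; set q := picard a k y; set e := 2^-1 ^+ k.
  move=> H1 H2 H3 H4; rewrite (distrC p) in H4 => H5.
  have -> : W a x - W a y = (W a x - p) + (p - q) + (q - W a y) by ring.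
  by have := ler_normD (W a x - p + (p - q)) (q - W a y);
     have := ler_normD (W a x - p) (p - q); lra.
exists W; split=> //.
- move=> a s; apply/eqP; rewrite -subr_eq0 -normr_le0.
  set B := 2 * (`|F a| / L * expR (L * `|s|)).
  apply: (@le_of_geometric _ _ B) => k.
  have H1 := HW a s k.+1; rewrite distrC in H1.
  have H t : `|picard a k t - W a t| <=
      (2 * (`|F a| / L) * 2^-1 ^+ k) * expR (L * `|t|).
    by rewrite mulrAC -[X in X * _]mulrA; exact: HW.
  have := picard_step_dist a a s (picard_lipschitz a k) (Wll a) H.
  rewrite subrr normr0 add0r => H2.
  have := ler_normD (W a s - picard a k.+1 s) (picard a k.+1 s - picard_step a (W a) s).
  rewrite addrA subrK => H3; rewrite add0r; apply: le_trans H3 _.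
  apply: le_trans (lerD H1 H2) _; rewrite /B exprS.
  by rewrite -subr_ge0 [X in 0 <= X](_ : _ = 0)//; field; rewrite gt_eqF.
- move=> a b s; have [C HC] := Wpicard a b s.
  apply: (@le_of_geometric _ _ C) => k; apply: le_trans (HC k) _; rewrite lerD2r.
  (* The bound reproduces itself: a step yields [|a - b| + |a - b| * expR _], and the weight is at
     least 1. *)
  elim: k s {C HC} => [|k IH] s.
    by rewrite /= mulrAC ler_peMl// (le_trans _ (_ : 2 * 1 <= _)) ?ler_wpM2l ?weight_ge1// mulr1 ler1n.
  apply: le_trans (picard_step_dist a b s (picard_lipschitz a k) (picard_lipschitz b k) IH) _.
  have -> : 2 * `|a - b| / 2 = `|a - b| by field.
  rewrite [leRHS](_ : _ = `|a - b| * expR (L * `|s|) + `|a - b| * expR (L * `|s|)); last by ring.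
  by rewrite lerD2r ler_peMr// weight_ge1.
Qed.
End Picard.

(** * The nonlinearity and its potential *)

Section Nonlinearity.
Context {R : realType}.
Implicit Types (u a s t : R).

Definition nonlin u : R := u - 3 * u ^+ 3 + u ^+ 5.

Definition nonlin' u : R := 1 - 9 * u ^+ 2 + 5 * u ^+ 4.

(** The [F] of the energy, a mechanical potential up to sign; not to be confused with [W]. *)
Definition potential u : R := 2^-1 * u ^+ 2 - 3 / 4 * u ^+ 4 + 6^-1 * u ^+ 6.

Definition clamp u : R := Num.max 0 (Num.min u 2).

Lemma clamp_id u : 0 <= u <= 2 -> clamp u = u.
Proof. by move=> /andP[u0 u2]; rewrite /clamp min_l// max_r. Qed.

Lemma clamp_itv u : 0 <= clamp u <= 2.
Proof.
by rewrite /clamp le_max lexx/= ge_max ler0n/= ge_min lexx orbT.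
Qed.

Lemma clamp_lipschitz : locally_lipschitz clamp.
Proof.
have cP z : (z <= 0 /\ clamp z = 0) \/ (0 <= z <= 2 /\ clamp z = z) \/
    (2 <= z /\ clamp z = 2).
  have [z0|z0] := leP z 0.
    by left; rewrite /clamp min_l ?max_l//; lra.
  right; have [z2|z2] := leP z 2; first by left; rewrite clamp_id; lra.
  by right; rewrite /clamp min_r ?max_r//; lra.
move=> S; exists 1 => // x y _ _; rewrite mul1r ler_norml.
have := ler_norm (x - y); have := ler_norm (- (x - y)); rewrite normrN.
by case: (cP x) => [[? ->]|[[? ->]|[? ->]]]; case: (cP y) => [[? ->]|[[? ->]|[? ->]]];
  lra.
Qed.

(* [nonlin] outside [0, 2] is replaced by its tangents, which makes it globally
   Lipschitz; the solution will be seen to stay in [0, 2]. *)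
Definition tnonlin : R -> R := primitive (nonlin' \o clamp).

Definition tpotential : R -> R := primitive tnonlin.

Lemma antiderivative_nonlin : antiderivative nonlin nonlin'.
Proof.
have D := antiderivativeD (antiderivativeB (@antiderivative_id R)
  (antiderivativeZ 3 (@antiderivativeX R 2))) (@antiderivativeX R 4).
by apply: antiderivative_ext D _ => x; rewrite /nonlin'; ring.
Qed.

Lemma antiderivative_potential : antiderivative potential nonlin.
Proof.
have D := antiderivativeD (antiderivativeB
  (antiderivativeZ 2^-1 (@antiderivativeX R 1))
  (antiderivativeZ (3 / 4) (@antiderivativeX R 3)))
  (antiderivativeZ 6^-1 (@antiderivativeX R 5)).
by apply: antiderivative_ext D _ => x; rewrite /nonlin; field.
Qed.

Lemma exprn_lipschitz n : locally_lipschitz (fun u : R => u ^+ n).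
Proof.
elim: n => [|n IH]; first exact: locally_lipschitz_cst.
by under eq_fun do rewrite exprS; exact/locally_lipschitzM/IH/locally_lipschitz_id.
Qed.

Lemma nonlin'_lipschitz : locally_lipschitz nonlin'.
Proof.
apply: locally_lipschitzD; last exact/locally_lipschitzZ/exprn_lipschitz.
under eq_fun do rewrite -mulNr.
apply: locally_lipschitzD; first exact: locally_lipschitz_cst.
exact/locally_lipschitzZ/exprn_lipschitz.
Qed.

Lemma tnonlin'_lipschitz : locally_lipschitz (nonlin' \o clamp).
Proof. exact: locally_lipschitz_comp nonlin'_lipschitz clamp_lipschitz. Qed.

Lemma antiderivative_tnonlin : antiderivative tnonlin (nonlin' \o clamp) /\ tnonlin 0 = 0.
Proof. exact/primitiveP/locally_lipschitz_continuous/tnonlin'_lipschitz. Qed.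

Lemma antiderivative_tpotential : antiderivative tpotential tnonlin /\ tpotential 0 = 0.
Proof.
exact/primitiveP/antiderivative_continuous/(proj1 antiderivative_tnonlin).
Qed.

(** The constant is [1 + 9 * 4 + 5 * 16], a crude bound for the derivative on [[0, 2]]. *)
Lemma tnonlin_dist x y : `|tnonlin x - tnonlin y| <= 117 * `|x - y|.
Proof.
have xS : `|x| <= `|x| + `|y| by rewrite lerDl.
have yS : `|y| <= `|x| + `|y| by rewrite lerDr.
have [D _] := antiderivative_tnonlin.
apply: (antiderivative_lip D _ xS yS) => t _.
rewrite /comp /nonlin'; have /andP[c0 c2] := clamp_itv t.
move: (clamp t) c0 c2 => c c0 c2.
have H2 : 0 <= c ^+ 2 <= 4 by rewrite exprn_ge0//= expr2; nra.
have -> : c ^+ 4 = (c ^+ 2) ^+ 2 by rewrite -exprM.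
move: (c ^+ 2) H2 => q /andP[q0 q4]; rewrite ler_norml; apply/andP; nra.
Qed.

Lemma tnonlinE u : 0 <= u <= 2 -> tnonlin u = nonlin u.
Proof.
move=> /andP[u0 u2]; have [D z] := antiderivative_tnonlin.
have D' := antiderivativeB D antiderivative_nonlin.
have E0 x : 0 < x < u -> (nonlin' \o clamp) x - nonlin' x = 0.
  by move=> x0; rewrite /comp clamp_id ?subrr//; lra.
have H1 := antiderivative_le D' u0; have H2 := antiderivative_ge D' u0.
move: H1 H2; rewrite z /nonlin !expr0n/= => H1 H2.
have {}H1 : _ := H1 (fun x xu => ltac:(by rewrite E0)).
have {}H2 : _ := H2 (fun x xu => ltac:(by rewrite E0)).
lra.
Qed.

Lemma tpotentialE u : 0 <= u <= 2 -> tpotential u = potential u.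
Proof.
move=> /andP[u0 u2]; have [D z] := antiderivative_tpotential.
have D' := antiderivativeB D antiderivative_potential.
have E0 x : 0 < x < u -> tnonlin x - nonlin x = 0.
  by move=> x0; rewrite tnonlinE ?subrr//; lra.
have H1 := antiderivative_le D' u0; have H2 := antiderivative_ge D' u0.
move: H1 H2; rewrite z /potential !expr0n/= => H1 H2.
have {}H1 : _ := H1 (fun x xu => ltac:(by rewrite E0)).
have {}H2 : _ := H2 (fun x xu => ltac:(by rewrite E0)).
lra.
Qed.

Definition phi : R := (1 + Num.sqrt 5) / 2.

Lemma phi_bounds : 8 / 5 < phi < 17 / 10.
Proof.
have s5 : Num.sqrt 5 ^+ 2 = 5 :> R by rewrite sqr_sqrtr.
have s0 : 0 <= Num.sqrt 5 :> R := sqrtr_ge0 _.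
by rewrite /phi; move: (Num.sqrt 5) s5 s0 => q; nra.
Qed.

Lemma phi_sqr : phi ^+ 2 = phi + 1.
Proof.
have s5 : Num.sqrt 5 ^+ 2 = 5 :> R by rewrite sqr_sqrtr.
by rewrite /phi; move: (Num.sqrt 5) s5 => q; rewrite !expr2; nra.
Qed.

Lemma nonlin_factor u : nonlin u = u * (u ^+ 2 - u - 1) * (u ^+ 2 + u - 1).
Proof. by rewrite /nonlin; ring. Qed.

Lemma tnonlin_phi : tnonlin phi = 0.
Proof.
have := phi_bounds => H; rewrite tnonlinE; last lra.
by rewrite nonlin_factor phi_sqr; ring.
Qed.

(** In the factorization, [u * (u ^ 2 + u - 1)] increases from 0.352 at [4/5], and [1 + u - u ^ 2]
    is concave: at least 1 up to [u = 1], then decreasing to its value at [a]. The bound is thus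
    uniform along a profile descending from [a]. *)
Lemma tnonlin_neg u a : 4 / 5 <= u <= a -> a < phi ->
  tnonlin u <= - (7 / 20 * Num.min 1 (1 + a - a ^+ 2)) .
Proof.
move=> /andP[u1 ua] aphi; have := phi_bounds => H.
rewrite tnonlinE; last lra.
rewrite nonlin_factor.
have A : u ^+ 2 - u - 1 <= - Num.min 1 (1 + a - a ^+ 2).
  rewrite lerNr ge_min; have [u1'|u1'] := leP u 1.
    by apply/orP; left; rewrite expr2; nra.
  by apply/orP; right; rewrite !expr2; nra.
have m0 : 0 <= Num.min 1 (1 + a - a ^+ 2).
  by rewrite le_min ler01/=; have := phi_sqr; rewrite !expr2; nra.
have B : 7 / 20 <= u * (u ^+ 2 + u - 1) by rewrite expr2; nra.
move: (Num.min _ _) A m0 => c A m0.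
rewrite mulrAC; move: (u * (u ^+ 2 + u - 1)) (u ^+ 2 - u - 1) B A => x y B A; nra.
Qed.

Lemma tnonlin_neg_gap a : 4 / 5 <= a < phi -> 0 < 7 / 20 * Num.min 1 (1 + a - a ^+ 2).
Proof.
move=> H; rewrite mulr_gt0// lt_min ltr01/=.
by have := phi_sqr; have := phi_bounds; rewrite !expr2; nra.
Qed.

Lemma tnonlin_lt0 u : 4 / 5 <= u < phi -> tnonlin u < 0.
Proof.
move=> /[dup] H /tnonlin_neg_gap c0; have := @tnonlin_neg u u.
by move: c0; set c := 7 / 20 * _ => c0 /(_ _ _); lra.
Qed.

(** The smallest positive zero [phi - 1] exceeds [2^-1]. *)
Lemma tnonlin_ge0 u : 0 <= u <= 2^-1 -> 0 <= tnonlin u.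
Proof.
move=> H; rewrite tnonlinE; last lra.
have -> : nonlin u = u * (1 - 3 * u ^+ 2 + (u ^+ 2) ^+ 2) by rewrite /nonlin; ring.
rewrite mulr_ge0//; first lra.
have : 0 <= u ^+ 2 <= 4^-1 by rewrite expr2; nra.
move: (u ^+ 2) => q ?; nra.
Qed.

Let potentialE u : potential u = u ^+ 2 * (2^-1 - 3 / 4 * u ^+ 2 + 6^-1 * (u ^+ 2) ^+ 2).
Proof. by rewrite /potential; ring. Qed.

(** The bracket decreases in [q = u ^ 2] up to [9/4] and is still about 0.088 at [q = 16/25]. *)
Lemma tpotential_lb u : 0 <= u <= 4 / 5 -> u ^+ 2 / 20 <= tpotential u.
Proof.
move=> H; rewrite tpotentialE; last lra.
rewrite potentialE ler_wpM2l ?sqr_ge0//.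
have : 0 <= u ^+ 2 <= 16 / 25 by rewrite expr2; nra.
move: (u ^+ 2) => q ?; nra.
Qed.

Lemma sqr_phi_ub u : 0 <= u <= phi -> u ^+ 2 <= 8 / 3.
Proof.
have B := phi_bounds; have p2 := phi_sqr => H.
have p3 : phi <= 5 / 3 by move: p2; rewrite expr2; nra.
suff : u ^+ 2 <= phi ^+ 2 by lra.
by rewrite ler_pXn2r ?nnegrE//; lra.
Qed.

Lemma tpotential_top u : 3 / 2 <= u <= 9 / 5 -> tpotential u <= - (2 / 5).
Proof.
move=> H; rewrite tpotentialE; last lra.
rewrite potentialE.
have : 9 / 4 <= u ^+ 2 <= 81 / 25 by rewrite expr2; nra.
move: (u ^+ 2) => q q94.
have : 2^-1 - 3 / 4 * q + 6^-1 * q ^+ 2 <= - (9 / 50) by rewrite expr2; nra.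
by move: (_ + _) => c; nra.
Qed.

Lemma tpotential_bound u : 0 <= u <= phi -> -1 <= tpotential u <= 1.
Proof.
move=> H; have B := phi_bounds; rewrite tpotentialE; last lra.
rewrite potentialE.
have : 0 <= u ^+ 2 <= 8 / 3 by rewrite sqr_ge0 sqr_phi_ub.
move: (u ^+ 2) => q q83.
(* The right side is the chord of the convex bracket over [[0, 8/3]]; the lower bound after it comes
   from the minimum at [q = 9/4]. *)
have : 2^-1 - 3 / 4 * q + 6^-1 * q ^+ 2 <= 2^-1 - 11 / 36 * q by rewrite expr2; nra.
have : - (35 / 100) <= 2^-1 - 3 / 4 * q + 6^-1 * q ^+ 2.
  by have := sqr_ge0 (q - 9 / 4); rewrite !expr2; lra.
move: (2^-1 - 3 / 4 * q + _) => c c1 c2; apply/andP; split; first nra.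
have : q * c <= q * (2^-1 - 11 / 36 * q) by rewrite ler_wpM2l//; lra.
by have := sqr_ge0 (q - 1); rewrite !expr2; nra.
Qed.

(** Together with the value at 2, a barrier that confines the critical profile for negative [s]. *)
Lemma tpotential_gt0_half : 0 < tpotential 2^-1.
Proof. by have := @tpotential_lb 2^-1; rewrite expr2; lra. Qed.

Lemma tpotential_gt0_two : 0 < tpotential 2.
Proof. by rewrite tpotentialE ?potentialE; lra. Qed.
End Nonlinearity.

(** * Radial profiles and their energy *)

Section Trajectory.
Context {R : realType} (n : nat).
Implicit Types (a b c s t : R).

(* Profiles are functions of [s = |x| ^ 2] in dimension [n.+1]:
   the Laplacian of [w (|x| ^ 2)] is [4 s w'' + 2 n.+1 w']. *)
Record trajectory (w p p1 : R -> R) : Prop := Trajectory {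
  trajectory_w : antiderivative w p;
  trajectory_p : antiderivative p p1;
  trajectory_p1 : locally_lipschitz p1;
  trajectory_avg : forall s, p s = 2^-1 * avg n (fun x => tnonlin (w x)) s;
  trajectory_ode : forall s, 4 * s * p1 s + 2 * n.+1%:R * p s = tnonlin (w s) }.

(** The second derivative comes from differentiating the average, and integration by parts in [t]
    turns the integral form back into the differential equation. Energies depend on both [w] and
    [w'], so both need Lipschitz dependence on the height. *)
Lemma trajectory_exists : exists W P P1 : R -> R -> R,
  [/\ forall a, trajectory (W a) (P a) (P1 a),
      forall a, W a 0 = a,
      forall a b s, `|W a s - W b s| <= 2 * `|a - b| * expR (117 * `|s|),
      forall a b s, `|P a s - P b s| <= 117 * `|a - b| * expR (117 * `|s|) &
      forall s, W phi s = phi].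
Proof.
have L0 : 0 < 117 :> R by rewrite ltr0n.
have [W [Wl WE W0 Wab]] := picard_limit n L0 (@tnonlin_dist R).
pose P a := half_avg n tnonlin (W a).
have WP a : antiderivative (W a) (P a) /\ W a 0 = a.
  have [D E] := picard_step_antiderivative n L0 (@tnonlin_dist R) a (Wl a).
  by have -> : W a = picard_step n tnonlin a (W a) by apply/funext => s; exact: WE.
pose h1 a x := (nonlin' \o clamp) (W a x) * P a x.
have h1P a : antiderivative (fun x => tnonlin (W a x)) (h1 a).
  exact: antiderivative_comp (proj1 antiderivative_tnonlin) (proj1 (WP a)).
have Pl a : locally_lipschitz (P a) := half_avg_lipschitz n L0 (@tnonlin_dist R) (Wl a).
have h1l a : locally_lipschitz (h1 a).
  apply: locally_lipschitzM (Pl a).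
  exact: locally_lipschitz_comp tnonlin'_lipschitz (Wl a).
exists W, P, (fun a s => 2^-1 * avg n.+2 (h1 a) s); split.
- move=> a; split.
  + exact: (proj1 (WP a)).
  + exact/antiderivativeZ/avg_antiderivative.
  + exact/locally_lipschitzZ/avg_locally_lipschitz.
  + by [].
  + move=> s; rewrite -(avg_parts n s (h1P a) (h1l a)) /P /half_avg.
    by field.
- by move=> a; case: (WP a).
- by [].
- move=> a b s.
  have := half_avg_dist n L0 (@tnonlin_dist R) s (Wl a) (Wl b) (Wab a b).
  by rewrite (_ : 117 * (2 * `|a - b|) / 2 = 117 * `|a - b|)//; field.
- move=> s; apply/eqP; rewrite -subr_eq0 -normr_le0.
  by have := W0 phi s; rewrite tnonlin_phi normr0 !mul0r mulr0.
Qed.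

Section Profile.
Context (w p p1 : R -> R) (wT : trajectory w p p1).

Let wp := trajectory_w wT.
Let pp1 := trajectory_p wT.
Let ode := trajectory_ode wT.
Let wc : continuous w := antiderivative_continuous wp.
Let pc : continuous p := antiderivative_continuous pp1.
Let p1c : continuous p1 := locally_lipschitz_continuous (trajectory_p1 wT).

Definition energy s := 2 * s * p s ^+ 2 - tpotential (w s).

Lemma energy_antiderivative :
  antiderivative energy (fun s => - (2 * n%:R * p s ^+ 2)).
Proof.
have D := antiderivativeB (antiderivativeM
  (antiderivativeZ 2 (@antiderivative_id R)) (antiderivativeM pp1 pp1))
  (antiderivative_comp (proj1 antiderivative_tpotential) wp).
have -> : energy = (fun x => 2 * x * (p x * p x) - (tpotential \o w) x).
  by apply/funext => x; rewrite /energy expr2.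
apply: antiderivative_ext D _ => s.
by rewrite -ode -natr1; ring.
Qed.

Lemma energy_nonincreasing s t : s <= t -> energy t <= energy s.
Proof.
move=> st; apply: (antiderivative_ge energy_antiderivative st) => x _.
by rewrite oppr_le0 mulr_ge0 ?sqr_ge0// mulr_ge0.
Qed.

Lemma energy_at_zero s : 0 <= s -> w s = 0 -> 0 <= energy s.
Proof.
move=> s0 ws; rewrite /energy ws (proj2 antiderivative_tpotential) subr0.
by rewrite mulr_ge0 ?sqr_ge0// mulr_ge0.
Qed.

(* On [s, 4 s] the profile would drop by about [3 s * sqrt (c / (4 s))]. *)
Lemma no_drift c t : 0 < c -> (forall s, t <= s -> 0 <= w s <= 2) ->
  ~ (forall s, t <= s -> c <= s * p s ^+ 2).
Proof.
move=> c0 w02 H.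
(* The term [2 / c] gives [s * c >= 2], against the bound [9 * s * c <= 16] that a variation of at
   most 2 over [[s, 4 s]] imposes. *)
pose s := `|t| + 2 / c + 1.
have c2 : 0 < 2 / c by rewrite divr_gt0.
have ts : t <= s by rewrite /s; have := ler_norm t; lra.
have s1 : 1 <= s by rewrite /s; have := normr_ge0 t; lra.
have sc : 2 <= s * c.
  have : 2 / c <= s by rewrite /s; have := normr_ge0 t; lra.
  by rewrite ler_pdivrMr.
have s4 : s < 4 * s by lra.
have [x /andP[sx x4] E] := antiderivative_MVT wp s4.
have Hx := H x (ltac:(lra)).
have := w02 s ts; have := w02 (4 * s) (ltac:(lra)).
have -> : w (4 * s) = w s + p x * (3 * s) by rewrite -[w (4 * s)](subrK (w s)) E; ring.
move=> A B.
have C : p x ^+ 2 * (9 * s ^+ 2) <= 4.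
  have -> : p x ^+ 2 * (9 * s ^+ 2) = (p x * (3 * s)) ^+ 2 by ring.
  by move: (p x * (3 * s)) A => y A; rewrite expr2; nra.
have q0 : 0 <= p x ^+ 2 by exact: sqr_ge0.
have D : c <= 4 * s * p x ^+ 2.
  by apply: le_trans Hx _; rewrite ler_wpM2r// ltW.
move: (p x ^+ 2) C D q0 => q; rewrite expr2 => C D q0.
have : 9 * s * c <= 16 by nra.
by nra.
Qed.

Lemma p_le c s : 0 <= s -> (forall t, 0 <= t <= s -> tnonlin (w t) <= - c) ->
  p s <= - (c / (2 * n.+1%:R)).
Proof.
move=> s0 H; rewrite (trajectory_avg wT) -ler_pdivlMl ?invr_gt0// invrK.
have -> : 2 * - (c / (2 * n.+1%:R)) = - c / n.+1%:R.
  have : n.+1%:R != 0 :> R by rewrite pnatr_eq0.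
  by move: (n.+1%:R) => N N0; field.
apply: avg_ub => [|t /andP[t0 t1]].
  move=> x; apply: (@continuous_comp _ _ _ w tnonlin); first exact: wc.
  exact: antiderivative_continuous (proj1 antiderivative_tnonlin) _.
by apply: H; rewrite mulr_ge0//= ler_piMl.
Qed.
End Profile.
End Trajectory.

(** * The shooting argument *)

Section Shooting.
Context {R : realType} (n : nat).
Implicit Types (a b c s t : R) (g : R -> R).

Lemma continuous_pos_near g x : continuous g -> 0 < g x ->
  exists2 e, 0 < e & forall t, `|x - t| < e -> 0 < g t.
Proof.
move=> gc gx.
have : (\forall t \near x, 0 < g t) by exact: (cvgr_gt _ (gc x) _ gx).
by move=> /nbhs_ballP[e e0 He]; exists e => // t; exact: He.
Qed.

Lemma first_zero g s : continuous g -> g 0 < 0 -> 0 <= s -> 0 <= g s ->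
  exists2 z, 0 < z <= s & g z = 0 /\ forall t, 0 <= t < z -> g t < 0.
Proof.
move=> gc g0 s0 gs.
have Ngc : continuous (fun x => - g x) by move=> x; apply: cvgN; exact: gc.
pose Z := [set t | 0 <= t /\ 0 <= g t].
have Zinf : has_inf Z by split; [exists s|exists 0 => t []].
have zle t : Z t -> inf Z <= t by exact: (ge_inf (proj2 Zinf)).
have z0 : 0 <= inf Z by apply: lb_le_inf; [case: Zinf|move=> t []].
have adh e : 0 < e -> exists2 t, Z t & t < inf Z + e.
  by move=> e0; exact: inf_adherent.
move: (inf Z) zle z0 adh => z zle z0 adh.
have before t : 0 <= t < z -> g t < 0.
  move=> /andP[t0 tz]; rewrite ltNge; apply/negP => gt.
  by have := zle t (conj t0 gt); rewrite leNgt tz.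
have gz0 : 0 <= g z.
  rewrite leNgt -oppr_gt0; apply/negP => gz.
  have [e e0 He] := continuous_pos_near Ngc gz.
  have [t Zt tz] := adh _ e0; have zt := zle t Zt.
  have : 0 < - g t by apply: He; rewrite ler0_norm; lra.
  by rewrite oppr_gt0 ltNge (proj2 Zt).
have zpos : 0 < z.
  by rewrite lt0r z0 andbT; apply: contraTneq gz0 => ->; rewrite -ltNge.
exists z; first by rewrite zpos; exact: zle.
split=> //; apply/eqP; rewrite eq_le gz0 andbT leNgt; apply/negP => gz.
have [e e0 He] := continuous_pos_near gc gz.
pose t := Num.max 0 (z - e / 2).
have tz : 0 <= t < z by rewrite /t le_max lexx/= gt_max zpos/=; lra.
have te : z - e / 2 <= t by rewrite /t le_max lexx orbT.
have : 0 < g t by apply: He; rewrite ger0_norm; lra.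
by rewrite ltNge (ltW (before t tz)).
Qed.

Section Profile.
Context (w p p1 : R -> R) (wT : trajectory n w p p1).

Let wp := trajectory_w wT.
Let pp1 := trajectory_p wT.
Let ode := trajectory_ode wT.
Let wc : continuous w := antiderivative_continuous wp.
Let pc : continuous p := antiderivative_continuous pp1.
Let p1c : continuous p1 := locally_lipschitz_continuous (trajectory_p1 wT).

Lemma w_nonincreasing s t : (forall x, s < x < t -> p x < 0) -> s <= t ->
  w t <= w s.
Proof. by move=> H st; apply: (antiderivative_ge wp st) => x /H /ltW. Qed.

(* At a first zero of [w'] the equation gives [w'' < 0]. *)
Lemma p_neg : 4 / 5 <= w 0 < phi ->
  (forall z, 0 < z -> (forall s, 0 <= s < z -> p s < 0) -> p z = 0 ->
     4 / 5 <= w z) ->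
  forall s, 0 <= s -> p s < 0.
Proof.
move=> w0 H s s0; rewrite ltNge; apply/negP => ps.
have p0 : p 0 < 0.
  have := ode 0; rewrite mulr0 mul0r add0r => E.
  have := tnonlin_lt0 w0; rewrite -E -mulrA pmulr_rlt0// pmulr_rlt0// ltr0n.
have [z /andP[z0 _] [pz before]] := first_zero pc p0 s0 ps.
have wz : w z <= w 0.
  by apply: w_nonincreasing (ltW z0) => x xz; apply: before; lra.
have := H z z0 before pz => wz1.
have fz : tnonlin (w z) < 0 by apply: tnonlin_lt0; lra.
have p1z : 0 < - p1 z.
  have := ode z; rewrite pz mulr0 addr0 => E; move: fz; rewrite -E; nra.
have Np1c : continuous (fun x => - p1 x) by move=> x; apply: cvgN; exact: p1c.
have [e e0 He] := continuous_pos_near Np1c p1z.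
pose t := Num.max 0 (z - e / 2).
have tz : 0 <= t < z by rewrite /t le_max lexx/= gt_max z0/=; lra.
have te : z - e / 2 <= t by rewrite /t le_max lexx orbT.
have tz' : t < z by lra.
have [x xz E] := antiderivative_MVT pp1 tz'.
have := before t tz; have := He x; rewrite pz in E.
have xe : `|z - x| < e by rewrite ger0_norm; lra.
by move=> /(_ xe) ? ?; nra.
Qed.

(* Gronwall: a double zero would force [w = w' = 0] down to [0]. *)
Lemma w_pos : 0 < w 0 -> (forall s, 0 <= s -> 0 <= w s) ->
  forall s, 0 <= s -> 0 < w s.
Proof.
move=> w0 wge s s0; rewrite ltNge; apply/negP => ws.
have Nwc : continuous (fun x => - w x) by move=> x; apply: cvgN; exact: wc.
have [|//||z /andP[z0 _] [/eqP wz before]] := @first_zero _ s Nwc.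
- by rewrite oppr_lt0.
- by rewrite oppr_ge0.
rewrite oppr_eq0 in wz; move/eqP in wz.
have pz : p z = 0.
  have z2 : 0 <= 2 * z by lra.
  have : is_derive z 1 w 0.
    apply: (derive1_at_min z2) => [t _||t].
    + by have [] := wp t.
    + by rewrite in_itv/=; lra.
    + by rewrite in_itv/= => /andP[t0 _]; rewrite wz wge// ltW.
  by move=> [_ <-]; have [_ ->] := wp z.
pose N : R := n.+1%:R; have N0 : 0 < N by rewrite ltr0n.
(* On [[z / 2, z]] the derivative of [w ^ 2 + p ^ 2] is at least [- K] times that sum: the 1 pays
   for [2 * w * p], the rest for [2 * p * p1], where the equation is divided by [4 * x >= 2 * z].
   Vanishing at [z] then contradicts [w (z / 2) > 0]. *)
pose K := 1 + (117 + 2 * N) / z.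
have KD : antiderivative (fun x => K * x) (fun=> K).
  by apply: antiderivative_ext (antiderivativeZ K (@antiderivative_id R)) _ => x; rewrite mulr1.
have D := antiderivativeM
  (antiderivativeD (antiderivativeM wp wp) (antiderivativeM pp1 pp1))
  (antiderivative_comp (fun x => is_derive_expR x) KD).
have z2 : z / 2 <= z by lra.
have := antiderivative_le D z2.
rewrite wz pz !mulr0 addr0 mul0r => /(_ _).
suff H : forall x, z / 2 < x < z -> 0 <= (p x * w x + w x * p x +
    (p1 x * p x + p x * p1 x)) * expR (K * x) +
    (w x * w x + p x * p x) * (expR (K * x) * K).
  move=> /(_ H); rewrite pmulr_lle0 ?expR_gt0//.
  have := before (z / 2) (ltac:(lra)); rewrite oppr_lt0; nra.
move=> x xz.
rewrite (_ : _ + _ = ((p x * w x + w x * p x + (p1 x * p x + p x * p1 x)) +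
  K * (w x * w x + p x * p x)) * expR (K * x)); last by ring.
rewrite mulr_ge0 ?expR_ge0//.
have F := tnonlin_dist (w x) 0; rewrite (proj2 antiderivative_tnonlin) !subr0 in F.
have E := ode x; rewrite -/N in E.
pose G := w x * w x + p x * p x.
have G0 : 0 <= G by rewrite /G; nra.
have wpG : 2 * `|w x * p x| <= G.
  have sq (y : R) : y * y = `|y| * `|y|.
    by rewrite -normrM ger0_norm// -expr2 sqr_ge0.
  rewrite normrM /G (sq (w x)) (sq (p x)).
  by have := sqr_ge0 (`|w x| - `|p x|); rewrite expr2; lra.
have A : - ((117 + 2 * N) * G) <= p x * tnonlin (w x) - 2 * N * p x ^+ 2.
  have H1 : `|p x * tnonlin (w x)| <= 117 * `|w x * p x|.
    by rewrite !normrM [`|w x| * _]mulrC mulrCA ler_wpM2l.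
  have H2 : p x ^+ 2 <= G by rewrite /G expr2; nra.
  have H3 : N * p x ^+ 2 <= N * G by rewrite ler_wpM2l// ltW.
  by have := ler_norm (- (p x * tnonlin (w x))); rewrite normrN; nra.
have x0 : 0 < x by lra.
have B : p x * p1 x = (p x * tnonlin (w x) - 2 * N * p x ^+ 2) / (4 * x).
  by rewrite -E; field; rewrite gt_eqF.
have C : - ((117 + 2 * N) * G / (2 * z)) <= p x * p1 x.
  rewrite B; apply: (@le_trans _ _ (- ((117 + 2 * N) * G) / (4 * x))).
    have HA : 0 <= (117 + 2 * N) * G by rewrite mulr_ge0//; lra.
    rewrite mulNr lerN2; apply: (ler_wpM2l HA).
    by rewrite lef_pV2 ?posrE; lra.
  by rewrite ler_wpM2r// invr_ge0; lra.
have -> : K * (w x * w x + p x * p x) = G + 2 * ((117 + 2 * N) * G / (2 * z)).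
  by rewrite /K -/G; field; rewrite gt_eqF.
by have := ler_norm (- (w x * p x)); rewrite normrN; lra.
Qed.

(** As long as [w] stays in [[4/5, w 0]], the nonlinearity is below a negative constant, and so is
    its average [p]. Then [s * p s ^ 2] is bounded below for [s >= 1], which [no_drift] excludes. *)
Lemma crosses : 4 / 5 <= w 0 < phi -> (forall s, 0 <= s -> p s < 0) ->
  exists2 s, 0 <= s & w s < 4 / 5.
Proof.
move=> w0 pneg; apply: contrapT => H.
have wge s : 0 <= s -> 4 / 5 <= w s.
  by move=> s0; rewrite leNgt; apply/negP => ws; apply: H; exists s.
have wle s : 0 <= s -> w s <= w 0.
  by move=> s0; apply: w_nonincreasing s0 => x xs; apply: pneg; lra.
have c0 := tnonlin_neg_gap w0.
have wf s : 0 <= s -> tnonlin (w s) <= - (7 / 20 * Num.min 1 (1 + w 0 - w 0 ^+ 2)).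
  move=> s0; apply: tnonlin_neg; last by lra.
  by rewrite wge// wle.
move: (7 / 20 * _) c0 wf => c c0 wf.
have B := @phi_bounds R.
have c1 : 0 < c / (2 * n.+1%:R) by rewrite divr_gt0// mulr_gt0// ltr0n.
apply: (@no_drift _ _ _ _ _ wT ((c / (2 * n.+1%:R)) ^+ 2) 1).
- by rewrite exprn_gt0.
- by move=> s s1; have := wge s (ltac:(lra)); have := wle s (ltac:(lra)); lra.
- move=> s s1.
  have s0 : 0 <= s by lra.
  have := p_le wT s0 (_ : forall t, 0 <= t <= s -> tnonlin (w t) <= - c).
  move=> /(_ (fun t ht => wf t (ltac:(by case/andP: ht)))).
  move: (c / _) c1 => k k0 pk.
  have : k ^+ 2 <= p s ^+ 2 by rewrite !expr2; nra.
  by have := sqr_ge0 (p s); nra.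
Qed.
End Profile.
End Shooting.

(** * The critical height *)

Section GroundState.
Context {R : realType} (n : nat).
Implicit Types (a b c s t q : R).

Lemma profile_zero (w : R -> R) s : continuous w -> 0 < w 0 -> 0 <= s ->
  w s < 0 -> exists2 z, 0 < z <= s & w z = 0.
Proof.
move=> wc w0 s0 ws.
have Nwc : continuous (fun x => - w x) by move=> x; apply: cvgN; exact: wc.
have [|//||z zs [/eqP]] := @first_zero _ (fun x => - w x) s Nwc.
- by rewrite oppr_lt0.
- by rewrite oppr_ge0 ltW.
by rewrite oppr_eq0 => /eqP wz _; exists z.
Qed.

(* While the profile stays near [phi] no energy is lost; afterwards the
   friction [n / r] is small, so that the energy stays positive. *)
Lemma sign_change (w p p1 : R -> R) q : trajectory n w p p1 ->
  4 / 5 <= w 0 < phi -> 16 * n%:R + 1 <= q -> 3 / 2 <= w (q ^+ 2) <= 9 / 5 ->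
  exists2 s, 0 <= s & w s < 0.
Proof.
move=> wT w0 nq wq; apply: contrapT => H.
have B := @phi_bounds R.
have n0 : 0 <= n%:R :> R by [].
have q1 : 1 <= q by lra.
have wge s : 0 <= s -> 0 <= w s.
  by move=> s0; rewrite leNgt; apply/negP => ws; apply: H; exists s.
have wle z : 0 <= z -> (forall s, 0 <= s < z -> p s < 0) -> w z <= w 0.
  by move=> z0 pz; apply: (w_nonincreasing wT) z0 => x xz; apply: pz; lra.
set S := q ^+ 2 in wq.
have S1 : 1 <= S by rewrite /S expr2; nra.
pose E := energy w p.
have ES : 2 / 5 <= E S.
  have := tpotential_top wq; rewrite /E /energy => F.
  have := mulr_ge0 (_ : 0 <= 2 * S) (sqr_ge0 (p S)); lra.
have E0 : E 0 <= 1.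
  rewrite /E /energy mulr0 mul0r add0r; have /tpotential_bound : 0 <= w 0 <= phi by lra.
  lra.
have EM s t : s <= t -> E t <= E s := energy_nonincreasing wT (s := s) (t := t).
have Elow z : 0 <= z -> (forall s, 0 <= s < z -> p s < 0) -> 3 / 20 <= E z.
  move=> z0 pz; have [zS|Sz] := leP z S; first by have := EM _ _ zS; lra.
  (* Since [p < 0] and [q * p >= -1], the loss rate [2 * n * p ^ 2] is at most [- k * p]. The loss
     beyond [S] is therefore at most [k] times the drop of [w], that is [9/40], out of the [2/5]
     available at [S]; [q >= 16 * n + 1] serves to make [k <= 1/8]. *)
  pose k := 2 * n%:R / q.
  have k0 : 0 <= k by rewrite /k divr_ge0//; lra.
  have k8 : k <= 8^-1 by rewrite /k ler_pdivrMr; lra.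
  have D := antiderivativeB (energy_antiderivative wT)
    (antiderivativeZ k (trajectory_w wT)).
  have := antiderivative_le D (ltW Sz).
  suff dpos : forall x, S < x < z -> 0 <= - (2 * n%:R * p x ^+ 2) - k * p x.
    move=> /(_ dpos); rewrite -/E => Ez.
    have kw : k * (w S - w z) <= 8^-1 * (9 / 5).
      have [d0|d0] := leP 0 (w S - w z); last first.
        have : k * (w S - w z) <= 0 by rewrite mulr_ge0_le0// ltW.
        lra.
      by apply: ler_pM => //; have := wge z z0; lra.
    by move: kw Ez ES; rewrite mulrBr; lra.
  move=> x xz.
  have px : p x < 0 by apply: pz; lra.
  have wx : 0 <= w x <= phi.
    rewrite wge ?(le_trans (wle x _ _))//; try lra.
    by move=> s sx; apply: pz; lra.
  have Ex : E x <= 1 by apply: le_trans (EM 0 x _) E0; lra.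
  have xp : x * p x ^+ 2 <= 1.
    by move: Ex; rewrite /E /energy; have := tpotential_bound wx; lra.
  have qp : (q * p x) ^+ 2 <= 1.
    rewrite exprMn; apply: le_trans xp; rewrite ler_wpM2r ?sqr_ge0//.
    by rewrite -/S; lra.
  have qp1 : -1 <= q * p x by move: (q * p x) qp => y; rewrite expr2; nra.
  have -> : - (2 * n%:R * p x ^+ 2) - k * p x = k * - p x * (1 + q * p x).
    by rewrite /k; field; lra.
  by rewrite mulr_ge0//; [rewrite mulr_ge0//|]; lra.
have pneg : forall s, 0 <= s -> p s < 0.
  apply: (p_neg wT w0) => z z0 before pz.
  have Ez := Elow z (ltW z0) before.
  rewrite leNgt; apply/negP => wz.
  have := @tpotential_lb _ (w z); rewrite wge ?(ltW z0)//= (ltW wz) => /(_ erefl).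
  move: Ez; rewrite /E /energy pz expr0n/= mulr0.
  by have := sqr_ge0 (w z); lra.
have [t t0 wt] := crosses wT w0 pneg.
have wts s : t <= s -> 0 <= w s <= 4 / 5.
  move=> ts; have s0 : 0 <= s by lra.
  rewrite wge//=; apply: le_trans (ltW wt).
  by apply: (w_nonincreasing wT) ts => x xz; apply: pneg; lra.
(* Half of [3/20]: below [4/5] the potential is nonnegative, so [2 * s * p s ^ 2] is at least the
   energy. *)
apply: (@no_drift _ _ _ _ _ wT (3 / 40) t); first lra.
  by move=> s ts; have := wts s ts; lra.
move=> s ts; have s0 : 0 <= s by lra.
have := Elow s s0 (fun x xs => pneg x (ltac:(by case/andP: xs))).
have := tpotential_lb (wts s ts); have := sqr_ge0 (w s).
by rewrite /E /energy; lra.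
Qed.

Lemma critical_trajectory : exists w p p1 : R -> R,
  [/\ trajectory n w p p1, 4 / 5 <= w 0 < phi, forall s, 0 <= s -> 0 < w s &
      forall s, 0 <= s -> 0 <= energy w p s].
Proof.
have [W [P [P1 [WT W0 Wd Pd Wphi]]]] := @trajectory_exists R n.
have B := @phi_bounds R.
have Wc a : continuous (W a).
  exact: antiderivative_continuous (trajectory_w (WT a)).
pose Z := [set a | 4 / 5 <= a < phi /\ exists2 s, 0 <= s & W a s < 0].
have Zinf : has_inf Z.
  split; last by exists (4 / 5) => a [/andP[]].
  pose q : R := 16 * n%:R + 1; pose S := q ^+ 2.
  have S0 : 0 <= S := sqr_ge0 q.
  pose e := expR (117 * `|S|); have e0 : 1 <= e.
    by rewrite -expR0 ler_expR mulr_ge0.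
  (* So close to the stationary height that the profile is still within [1/10] of [phi] at [S],
     hence between [3/2] and [9/5]. *)
  pose a := phi - (20 * e)^-1.
  have ae : 0 < (20 * e)^-1 by rewrite invr_gt0; lra.
  have ae' : (20 * e)^-1 <= 20^-1 by rewrite lef_pV2 ?posrE; lra.
  have a1 : 4 / 5 <= a < phi by rewrite /a; lra.
  exists a; split=> //; apply: (sign_change (q := q) (WT a)); rewrite ?W0//.
  have := Wd a phi S; rewrite Wphi -/S -/e.
  have -> : `|a - phi| = (20 * e)^-1.
    by rewrite /a addrAC subrr add0r normrN gtr0_norm.
  have -> : 2 * (20 * e)^-1 * e = 10^-1 by field; lra.
  by rewrite ler_norml => /andP[? ?]; apply/andP; lra.
pose al := inf Z.
have alle b : Z b -> al <= b by exact: (ge_inf (proj2 Zinf)).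
have al1 : 4 / 5 <= al by apply: lb_le_inf; [case: Zinf|move=> b [/andP[]]].
have alphi : al < phi.
  by have [[b Zb] _] := Zinf; apply: le_lt_trans (alle b Zb) _; case: Zb => /andP[].
have Wll s : locally_lipschitz (fun b => W b s).
  move=> S; exists (2 * expR (117 * `|s|)) => [|b c _ _]; first by rewrite mulr_ge0// expR_ge0.
  by rewrite mulrAC; exact: Wd.
have Pll s : locally_lipschitz (fun b => P b s).
  move=> S; exists (117 * expR (117 * `|s|)) => [|b c _ _]; first by rewrite mulr_ge0// expR_ge0.
  by rewrite mulrAC; exact: Pd.
have ge0 s : 0 <= s -> 0 <= W al s.
  move=> s0; rewrite leNgt; apply/negP => ws.
  (* At the left end the energy starts negative, so that no zero can be reached. Otherwise a
     negative value persists at slightly smaller heights, against the choice of the infimum. *)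
  have [al45|al45] : al = 4 / 5 \/ 4 / 5 < al by move: al1; rewrite le_eqVlt => /predU1P[]; auto.
    have W0pos : 0 < W al 0 by rewrite W0; lra.
    have [z /andP[z0 _] wz] := profile_zero (Wc al) W0pos s0 ws.
    have := energy_at_zero (P al) (ltW z0) wz.
    have := energy_nonincreasing (WT al) (ltW z0).
    rewrite /energy mulr0 mul0r add0r W0 al45.
    have := @tpotential_lb R (4 / 5); rewrite lexx andbT => /(_ (ltac:(lra))).
    by rewrite expr2; lra.
  have Nc : continuous (fun b => - W b s).
    by move=> b; apply: cvgN; exact: (locally_lipschitz_continuous (Wll s)).
  have [|e e0 He] := @continuous_pos_near _ _ al Nc; first by rewrite oppr_gt0.
  pose b := Num.max (4 / 5) (al - e / 2).
  have bal : 4 / 5 <= b < al by rewrite /b le_max lexx/= gt_max al45/=; lra.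
  have be : al - e / 2 <= b by rewrite /b le_max lexx orbT.
  have : 0 < - W b s by apply: He; rewrite ger0_norm; lra.
  rewrite oppr_gt0 => wb.
  have Zb : Z b by split; [lra|exists s].
  by have := alle b Zb; lra.
exists (W al), (P al), (P1 al); rewrite W0; split=> //.
- by rewrite al1 alphi.
- by apply: (w_pos (WT al)) => //; rewrite W0; lra.
move=> s s0; rewrite leNgt; apply/negP => Es.
have pos : forall s, 0 <= s -> 0 < W al s.
  by apply: (w_pos (WT al)) => //; rewrite W0; lra.
have [c c0s cmin] := EVT_min s0 (continuous_subspaceT (Wc al)).
have mpos : 0 < W al c by apply: pos; move: c0s; rewrite in_itv/= => /andP[].
have Ell : locally_lipschitz (fun b => energy (W b) (P b) s).
  rewrite /energy; apply: locally_lipschitzD.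
    apply: locally_lipschitzZ; under eq_fun do rewrite expr2.
    exact: locally_lipschitzM.
  under eq_fun do rewrite -mulN1r.
  apply: locally_lipschitzZ; apply: (@locally_lipschitz_comp _ tpotential) => //.
  apply: antiderivative_locally_lipschitz (proj1 antiderivative_tpotential) _.
  exact: antiderivative_locally_lipschitz (proj1 antiderivative_tnonlin) tnonlin'_lipschitz.
have Nc : continuous (fun b => - energy (W b) (P b) s).
  by move=> b; apply: cvgN; exact: (locally_lipschitz_continuous Ell).
have [|e e0 He] := @continuous_pos_near _ _ al Nc; first by rewrite oppr_gt0.
pose X := expR (117 * `|s|); have X0 : 0 < X by rewrite expR_gt0.
(* Heights in [Z] within [e'] of [al] have profiles still positive on [[0, s]] and energy still
   negative at [s]. Their zero comes after [s], where the energy would have to be nonnegative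
   again. *)
pose e' := Num.min e (W al c / (2 * X)).
have e'0 : 0 < e' by rewrite lt_min e0 divr_gt0// mulr_gt0.
have [b Zb be] := inf_adherent e'0 Zinf.
have alb := alle b Zb.
rewrite -/al in be.
have Eb : energy (W b) (P b) s < 0.
  rewrite -oppr_gt0; apply: He; rewrite ler0_norm; last lra.
  have : e' <= e by rewrite /e' ge_min lexx.
  lra.
have bpos t : 0 <= t <= s -> 0 < W b t.
  move=> ts; have ct := cmin t; rewrite in_itv/= in ct; have {}ct := ct ts.
  have H1 : `|W b t - W al t| < W al c.
    apply: le_lt_trans (Wd _ _ _) _.
    apply: (@le_lt_trans _ _ (2 * `|b - al| * X)).
      rewrite ler_wpM2l ?mulr_ge0// ler_expR ler_wpM2l//.
      by rewrite !ger0_norm; lra.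
    have : `|b - al| < W al c / (2 * X).
      rewrite ger0_norm; last lra.
      have : e' <= W al c / (2 * X) by rewrite /e' ge_min lexx orbT.
      lra.
    by rewrite ltr_pdivlMr ?mulr_gt0// mulrA [_ * 2]mulrC.
  by move: H1; rewrite ltr_norml => /andP[]; lra.
have [bphi [s' s'0 ws']] := Zb.
have W0b : 0 < W b 0 by rewrite W0; lra.
have [z /andP[z0 _] wz] := profile_zero (Wc b) W0b s'0 ws'.
have sz : s <= z.
  rewrite leNgt; apply/negP => zs.
  by have := bpos z (ltac:(lra)); rewrite wz ltxx.
have := energy_nonincreasing (WT b) sz.
have := energy_at_zero (P b) (ltW z0) wz.
lra.
Qed.
End GroundState.

(** * Decay of the critical profile *)

Section Profile.
Context {R : realType} (n : nat).
Implicit Types (a b c s t q : R) (g : R -> R) (N : nat).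

(** Restricted to [s >= 0] because profiles are composed with [|x| ^ 2]. *)
Definition rapid g := forall N, exists M, forall s, 0 <= s -> `|s ^+ N * g s| <= M.

Section Decay.
Context (w p p1 : R -> R) (wT : trajectory n w p p1).
Context (w0 : 4 / 5 <= w 0 < phi) (wpos : forall s, 0 <= s -> 0 < w s).
Context (Epos : forall s, 0 <= s -> 0 <= energy w p s).

Let wp := trajectory_w wT.
Let pp1 := trajectory_p wT.
Let ode := trajectory_ode wT.
Let wc : continuous w := antiderivative_continuous wp.

(** At a first zero of [p] below height [4/5] the energy would be [- F (w z) < 0]. *)
Lemma critical_p_neg s : 0 <= s -> p s < 0.
Proof.
apply: (p_neg wT w0) => z z0 before pz.
rewrite leNgt; apply/negP => wz.
have wz0 := wpos (ltW z0).
have wz1 : 0 <= w z <= 4 / 5 by rewrite (ltW wz0) (ltW wz).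
have := tpotential_lb wz1.
have := Epos (ltW z0); rewrite /energy pz expr0n/= mulr0.
by have := exprn_gt0 2 wz0; lra.
Qed.

Lemma critical_le s t : 0 <= s <= t -> w t <= w s.
Proof.
move=> st; have st' : s <= t by lra.
by apply: (w_nonincreasing wT) st' => x xs; apply: critical_p_neg; lra.
Qed.

(** The truncation must be removed on the whole line. For [s <= 0] the kinetic term is nonpositive
    and the energy is at least its value at 0, so [F (w s) <= 0]. By continuity [w] can leave
    [[0, 2]] only by crossing [2^-1] or [2], where [F > 0]. *)
Lemma critical_range s : 0 <= w s <= 2.
Proof.
have B := @phi_bounds R; have w0' := w0.
have [s0|s0] := leP 0 s.
  by have := @critical_le 0 s; rewrite lexx/= => /(_ s0); have := wpos s0; lra.
have Fle t : t <= 0 -> tpotential (w t) <= 0.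
  move=> t0; have := energy_nonincreasing wT t0; have := Epos (lexx 0).
  have : 2 * t * p t ^+ 2 <= 0 by apply: mulr_le0_ge0; [lra|exact: sqr_ge0].
  by rewrite {3}/energy; lra.
have nohit v : 0 < tpotential v -> ~ (Num.min (w s) (w 0) <= v <= Num.max (w s) (w 0)).
  move=> Fv /(IVT (ltW s0) (continuous_subspaceT wc))[c].
  rewrite in_itv/= => /andP[_ c0] wcv.
  by have := Fle c c0; rewrite wcv; lra.
apply/andP; split; rewrite leNgt; apply/negP => ws.
  apply: (nohit _ (@tpotential_gt0_half R)).
  by rewrite ge_min le_max; apply/andP; split; apply/orP; [left|right]; lra.
apply: (nohit _ (@tpotential_gt0_two R)).
by rewrite ge_min le_max; apply/andP; split; apply/orP; [right|left]; lra.
Qed.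

(* [E >= 0] and [tpotential u >= u ^ 2 / 20] give [s w' <= - N w] for large [s]. *)
Lemma critical_rapid : rapid w.
Proof.
have [t t0 wt] := crosses wT w0 critical_p_neg.
have w00 : 0 < w 0 := wpos (lexx 0).
case=> [|N].
  exists (w 0) => s s0; rewrite expr0 mul1r gtr0_norm ?wpos//.
  by apply: critical_le; rewrite lexx.
pose K : R := N.+1%:R.
have K0 : 0 < K by rewrite ltr0n.
(* Past [t] one has [w ^ 2 <= 40 * x * p ^ 2], and [x >= 40 * K ^ 2] turns this into
   [K * w <= - x * p]: from [S] on, [x ^ K * w] is nonincreasing. *)
pose S := t + 40 * K ^+ 2.
have S0 : 0 <= S by rewrite addr_ge0// mulr_ge0 ?sqr_ge0.
exists (S ^+ N.+1 * w 0) => s s0.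
have ws := wpos s0.
rewrite ger0_norm; last by rewrite mulr_ge0 ?exprn_ge0// ltW.
have base x : 0 <= x <= S -> x ^+ N.+1 * w x <= S ^+ N.+1 * w 0.
  move=> /andP[x0 xS]; apply: ler_pM => //; first exact: exprn_ge0.
  - by rewrite ltW// wpos.
  - by rewrite ler_pXn2r// nnegrE.
  - by apply: critical_le; rewrite lexx.
have [sS|Ss] := leP s S; first by apply: base; rewrite s0.
apply: (@le_trans _ _ (S ^+ N.+1 * w S)); last by apply: base; rewrite S0/=.
have D := antiderivativeM (@antiderivativeX R N) wp.
apply: (antiderivative_ge D (ltW Ss)) => x xS.
have x0 : 0 < x by lra.
have tx : t <= x.
  have : 0 <= 40 * K ^+ 2 by rewrite mulr_ge0 ?sqr_ge0.
  by rewrite /S in xS; lra.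
have xK : 40 * K ^+ 2 <= x by rewrite /S in xS; lra.
have wx0 := wpos (ltW x0).
have wx : 0 <= w x <= 4 / 5.
  rewrite ltW//=; apply: le_trans (ltW wt); apply: critical_le; lra.
have px := critical_p_neg (ltW x0).
have Ex := Epos (ltW x0); have Fx := tpotential_lb wx.
rewrite -/K exprS -mulrA (_ : _ + _ = x ^+ N * (K * w x + x * p x)); last by ring.
rewrite mulr_ge0_le0 ?exprn_ge0 ?(ltW x0)//.
have H1 : w x ^+ 2 <= 40 * (x * p x ^+ 2) by rewrite /energy in Ex; lra.
have H2 : (K * w x) ^+ 2 <= (- (x * p x)) ^+ 2.
  rewrite sqrrN !exprMn.
  apply: (@le_trans _ _ (K ^+ 2 * (40 * (x * p x ^+ 2)))).
    by rewrite ler_wpM2l// sqr_ge0.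
  rewrite (_ : K ^+ 2 * _ = (40 * K ^+ 2) * (x * p x ^+ 2)); last by ring.
  rewrite (_ : x ^+ 2 * _ = x * (x * p x ^+ 2)); last by ring.
  by rewrite ler_wpM2r// mulr_ge0 ?sqr_ge0// ltW.
have H3 : 0 <= - (x * p x) by rewrite -mulrN mulr_ge0; lra.
move: H2; rewrite ler_pXn2r ?nnegrE//; first by lra.
by rewrite mulr_ge0 ?(ltW K0) ?(ltW wx0).
Qed.

(** Once [w <= 2^-1], the nonlinearity is nonnegative and [p < 0], so the equation makes [p]
    nondecreasing. Then [- p s] is at most the drop of [w] over [[s - 1, s]], hence at most
    [w (s - 1)]. *)
Lemma critical_rapid_p : rapid p.
Proof.
move=> N.
have [M1 H1] := critical_rapid 1; have [MN HN] := critical_rapid N.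
have M10 : 0 <= M1 := le_trans (normr_ge0 _) (H1 0 (lexx 0)).
have MN0 : 0 <= MN := le_trans (normr_ge0 _) (HN 0 (lexx 0)).
(* Beyond [2 * M1] the bound [s * w s <= M1] gives [w s <= 2^-1]; the extra 1 ensures
   [s <= 2 * (s - 1)] for [s > S + 1]. *)
pose S := 2 * M1 + 1.
have S1 : 1 <= S by rewrite /S; lra.
have half s : S <= s -> 0 <= w s <= 2^-1.
  move=> Ss; have s0 : 0 < s by lra.
  have ws := wpos (ltW s0); rewrite (ltW ws)/=.
  have := H1 s (ltW s0); rewrite expr1 ger0_norm ?mulr_ge0 ?(ltW s0) ?(ltW ws)// => H.
  rewrite -(ler_pM2l s0); apply: le_trans H _; rewrite /S in Ss; lra.
have mono s t : S <= s -> s <= t -> p s <= p t.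
  move=> Ss st; apply: (antiderivative_le pp1 st) => x xst.
  have x0 : 0 < x by lra.
  have px := critical_p_neg (ltW x0).
  have Sx : S <= x by lra.
  have fx := tnonlin_ge0 (half x Sx).
  have Np : n.+1%:R * p x <= 0 by rewrite mulr_ge0_le0// ltW.
  have : 0 <= 4 * x * p1 x by have := ode x; move: (n.+1%:R : R) Np => r Np; lra.
  by rewrite pmulr_rge0// mulr_gt0.
have [K K0 HK] := locally_lipschitz_bounded (antiderivative_locally_lipschitz pp1 (trajectory_p1 wT)) (S + 1).
exists ((S + 1) ^+ N * K + 2 ^+ N * MN) => s s0.
have A0 : 0 <= (S + 1) ^+ N * K by rewrite mulr_ge0// exprn_ge0; lra.
have B0 : 0 <= 2 ^+ N * MN by rewrite mulr_ge0// exprn_ge0.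
have [sS|Ss] := leP s (S + 1).
  rewrite normrM (ger0_norm (exprn_ge0 _ s0)).
  apply: (@le_trans _ _ ((S + 1) ^+ N * K)); last by lra.
  apply: ler_pM => //; rewrite ?exprn_ge0//.
    by rewrite lerXn2r ?nnegrE//; lra.
  by apply: HK; rewrite ger0_norm.
have s1 : s - 1 < s by lra.
have [x xs E] := antiderivative_MVT wp s1.
rewrite opprB addrCA subrr addr0 mulr1 in E.
have ps := critical_p_neg s0.
have pw : - p s <= w (s - 1).
  by have := mono x s (ltac:(lra)) (ltac:(lra)); have := wpos s0; lra.
rewrite normrM (ger0_norm (exprn_ge0 _ s0)) ltr0_norm//.
apply: (@le_trans _ _ (2 ^+ N * MN)); last by lra.
have s10 : 0 <= s - 1 by lra.
apply: (@le_trans _ _ ((2 * (s - 1)) ^+ N * w (s - 1))).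
  apply: ler_pM => //; rewrite ?exprn_ge0//; first lra.
  by rewrite lerXn2r ?nnegrE//; lra.
rewrite exprMn -mulrA ler_wpM2l ?exprn_ge0//.
exact: le_trans (ler_norm _) (HN _ s10).
Qed.
End Decay.

Lemma ground_state_profile : exists w p p1 : R -> R,
  [/\ antiderivative w p, antiderivative p p1 & locally_lipschitz p1] /\
  [/\ forall s, p s = 2^-1 * avg n (fun x => nonlin (w x)) s,
      forall s, 4 * s * p1 s + 2 * n.+1%:R * p s = nonlin (w s),
      0 < w 0, rapid w & rapid p].
Proof.
have [w [p [p1 [wT w0 wpos Epos]]]] := @critical_trajectory R n.
have fE : (fun x => tnonlin (w x)) = (fun x => nonlin (w x)).
  by apply/funext => x; apply: tnonlinE; exact: (critical_range wT).
exists w, p, p1; split; first by case: wT.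
split.
- by move=> s; rewrite (trajectory_avg wT) fE.
- by move=> s; rewrite (trajectory_ode wT) -[LHS]/((fun x => tnonlin (w x)) s) fE.
- by apply: wpos.
- exact: (critical_rapid wT).
- exact: (critical_rapid_p wT).
Qed.
End Profile.

(** * Smoothness and rapid decay *)

Section RapidSmooth.
Context {R : realType}.
Implicit Types (g h : R -> R) (k N m : nat) (c s x : R).

Lemma antiderivative_unique h g1 g2 : antiderivative h g1 ->
  antiderivative h g2 -> g1 = g2.
Proof.
move=> h1 h2; apply/funext => x.
by have [_ <-] := h1 x; have [_ <-] := h2 x.
Qed.

(** Functions of class [C^k] whose last derivative is locally Lipschitz: the hypothesis under which
    averages can be differentiated. *)
Fixpoint Ck k g : Prop :=
  if k is k'.+1 then exists2 g', antiderivative g g' & Ck k' g'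
  else locally_lipschitz g.

Lemma Ck_lipschitz k g : Ck k g -> locally_lipschitz g.
Proof.
elim: k g => [//|k IH] g [g' gg' /IH].
exact: antiderivative_locally_lipschitz.
Qed.

Lemma CkW k g : Ck k.+1 g -> Ck k g.
Proof.
elim: k g => [|k IH] g; first exact: Ck_lipschitz.
by move=> [g' gg' /IH kg']; exists g'.
Qed.

Lemma CkD k g h : Ck k g -> Ck k h -> Ck k (fun x => g x + h x).
Proof.
elim: k g h => [|k IH] g h; first exact: locally_lipschitzD.
move=> [g' gg' kg'] [h' hh' kh']; exists (fun x => g' x + h' x).
  exact: antiderivativeD.
exact: IH.
Qed.

Lemma CkM k g h : Ck k g -> Ck k h -> Ck k (fun x => g x * h x).
Proof.
elim: k g h => [|k IH] g h; first exact: locally_lipschitzM.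
move=> /[dup] /CkW kg [g' gg' kg'] /[dup] /CkW kh [h' hh' kh'].
exists (fun x => g' x * h x + g x * h' x); first exact: antiderivativeM.
by apply: CkD; exact: IH.
Qed.

Lemma Ck_cst k c : Ck k (fun=> c).
Proof.
elim: k c => [|k IH] c; first exact: locally_lipschitz_cst.
by exists (fun=> 0); [exact: antiderivative_cst|exact: IH].
Qed.

Lemma Ck_avg k m g : Ck k g -> Ck k (avg m g).
Proof.
elim: k m g => [|k IH] m g; first exact: avg_locally_lipschitz.
move=> [g' gg' kg']; exists (avg m.+2 g'); last exact: IH.
exact: avg_antiderivative gg' (Ck_lipschitz kg').
Qed.

Lemma nonlin_compE g : (fun x => nonlin (g x)) = (fun x =>
  g x + (-3 * (g x * (g x * g x)) + g x * (g x * (g x * (g x * g x))))).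
Proof. by apply/funext => x; rewrite /nonlin; ring. Qed.

Lemma Ck_nonlin k g : Ck k g -> Ck k (fun x => nonlin (g x)).
Proof.
move=> kg; rewrite nonlin_compE; apply: CkD => //; apply: CkD; last first.
  by do !apply: CkM.
by apply: CkM; [exact: Ck_cst|do !apply: CkM].
Qed.

Definition Cinf g := forall k, Ck k g.

Lemma Cinf_derive g : Cinf g -> exists2 g', antiderivative g g' & Cinf g'.
Proof.
move=> kg; have [g' gg' _] := kg 1%N; exists g' => // k.
by have [h gh kh] := kg k.+1; rewrite (antiderivative_unique gg' gh).
Qed.

Lemma rapidD g h : rapid g -> rapid h -> rapid (fun x => g x + h x).
Proof.
move=> gr hr N; have [M HM] := gr N; have [K HK] := hr N.
exists (M + K) => s s0; rewrite mulrDr (le_trans (ler_normD _ _))//.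
by rewrite lerD ?HM ?HK.
Qed.

Lemma rapidM g h : rapid g -> rapid h -> rapid (fun x => g x * h x).
Proof.
move=> gr hr N; have [M HM] := gr N; have [K HK] := hr 0%N.
exists (M * K) => s s0; rewrite mulrA normrM ler_pM ?HM//.
by have := HK s s0; rewrite mul1r.
Qed.

Lemma rapidZ c g : rapid g -> rapid (fun x => c * g x).
Proof.
move=> gr N; have [M HM] := gr N.
by exists (`|c| * M) => s s0; rewrite mulrCA normrM ler_wpM2l ?HM.
Qed.

Lemma rapid_mulX g : rapid g -> rapid (fun x => x * g x).
Proof.
move=> gr N; have [M HM] := gr N.+1.
by exists M => s s0; rewrite mulrA -exprSr HM.
Qed.

Lemma rapid_divX g : locally_lipschitz g -> rapid (fun x => x * g x) -> rapid g.
Proof.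
move=> gl gr N; have [M HM] := gr N; have [K K0 HK] := locally_lipschitz_bounded gl 1.
have M0 : 0 <= M := le_trans (normr_ge0 _) (HM 0 (lexx 0)).
exists (M + K) => s s0; rewrite normrM (ger0_norm (exprn_ge0 _ s0)).
have [s1|s1] := leP s 1.
  apply: (@le_trans _ _ (1 * K)); last by lra.
  apply: ler_pM; rewrite ?exprn_ge0 ?exprn_ile1//.
  by apply: HK; rewrite ger0_norm.
apply: (@le_trans _ _ M); last by lra.
apply: le_trans (HM s s0); rewrite !normrM (ger0_norm (exprn_ge0 _ s0)).
apply: ler_wpM2l; first exact: exprn_ge0.
by rewrite ler_peMl// ger0_norm// ltW.
Qed.

Fixpoint Sk k g : Prop := rapid g /\
  if k is k'.+1 then exists2 g', antiderivative g g' & Sk k' g' else True.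

Lemma Sk_rapid k g : Sk k g -> rapid g.
Proof. by case: k => [|k] []. Qed.

Lemma SkW k g : Sk k.+1 g -> Sk k g.
Proof.
elim: k g => [|k IH] g [gr [g' gg' kg']]; first by split.
by split=> //; exists g' => //; exact: IH.
Qed.

Lemma SkD k g h : Sk k g -> Sk k h -> Sk k (fun x => g x + h x).
Proof.
elim: k g h => [|k IH] g h [gr gk] [hr hk]; split=> //; try exact: rapidD.
move: gk hk => [g' gg' kg'] [h' hh' kh']; exists (fun x => g' x + h' x).
  exact: antiderivativeD.
exact: IH.
Qed.

Lemma SkM k g h : Sk k g -> Sk k h -> Sk k (fun x => g x * h x).
Proof.
elim: k g h => [|k IH] g h /[dup] kg [gr gk] /[dup] kh [hr hk];
  split=> //; try exact: rapidM.
move: gk hk => [g' gg' kg'] [h' hh' kh'].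
exists (fun x => g' x * h x + g x * h' x); first exact: antiderivativeM.
by apply: SkD; apply: IH => //; exact: SkW.
Qed.

Lemma SkZ k c g : Sk k g -> Sk k (fun x => c * g x).
Proof.
elim: k g => [|k IH] g [gr gk]; split=> //; try exact: rapidZ.
move: gk => [g' gg' kg']; exists (fun x => c * g' x); last exact: IH.
exact: antiderivativeZ.
Qed.

Lemma antiderivative_mulX g g' : antiderivative g g' ->
  antiderivative (fun x => x * g x) (fun x => g x + x * g' x).
Proof.
move=> gg'; apply: antiderivative_ext (antiderivativeM (@antiderivative_id R) gg') _ => x.
by rewrite mul1r.
Qed.

Lemma Sk_mulX k g : Sk k g -> Sk k (fun x => x * g x).
Proof.
elim: k g => [|k IH] g /[dup] kg [gr gk]; split=> //; try exact: rapid_mulX.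
move: gk => [g' gg' kg']; exists (fun x => g x + x * g' x).
  exact: antiderivative_mulX.
by apply: SkD; [exact: SkW|exact: IH].
Qed.

(** Since [(x * g)' = g + x * g'] and [g] itself is settled by induction, [x * g'] inherits one
    order less and the induction applies to [g']. Smoothness of [g] supplies the bounds near 0,
    where division by [x] loses control. *)
Lemma Sk_divX k g : Cinf g -> Sk k (fun x => x * g x) -> Sk k g.
Proof.
elim: k g => [|k IH] g kg Sg.
  by split=> //; apply: rapid_divX (kg 0%N) _; case: Sg.
have Sg1 := IH g kg (SkW Sg); split; first exact: Sk_rapid Sg1.
have [g' gg' kg'] := Cinf_derive kg; exists g' => //.
apply: IH => //; case: Sg => _ [h gh kh].
have hE := antiderivative_unique gh (antiderivative_mulX gg').
rewrite [X in Sk _ X](_ : _ = fun x => h x + -1 * g x).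
  by apply: SkD => //; exact: SkZ.
by apply/funext => x; rewrite hE; ring.
Qed.

Lemma Sk_nonlin k g : Sk k g -> Sk k (fun x => nonlin (g x)).
Proof.
move=> kg; rewrite nonlin_compE; apply: SkD => //; apply: SkD; last by do !apply: SkM.
by apply: SkZ; do !apply: SkM.
Qed.

Definition Sinf g := forall k, Sk k g.

Lemma Sinf_derive g g' : Sinf g -> antiderivative g g' -> Sinf g'.
Proof.
move=> kg gg' k; have [_ [h gh kh]] := kg k.+1.
by rewrite (antiderivative_unique gg' gh).
Qed.

Section Solution.
Context (n : nat) (w p p1 : R -> R).
Context (wp : antiderivative w p) (pp1 : antiderivative p p1)
  (p1l : locally_lipschitz p1).
Context (pE : forall s, p s = 2^-1 * avg n (fun x => nonlin (w x)) s).
Context (ode : forall s, 4 * s * p1 s + 2 * n.+1%:R * p s = nonlin (w s)).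

(** Bootstrap: by [pE] the derivative [p] is as regular as [w], so [w] gains one order each time. *)
Lemma solution_Cinf : Cinf w.
Proof.
elim=> [|k IH].
  exact/(antiderivative_locally_lipschitz wp)/(antiderivative_locally_lipschitz pp1).
exists p => //.
have -> : p = fun s => 2^-1 * avg n (fun x => nonlin (w x)) s by apply/funext.
by apply: CkM; [exact: Ck_cst|exact/Ck_avg/Ck_nonlin].
Qed.

Lemma solution_Sinf : rapid w -> rapid p -> Sinf w /\ Sinf p.
Proof.
move=> wr pr.
have p1C : Cinf p1.
  have [q wq qC] := Cinf_derive solution_Cinf.
  have qp := antiderivative_unique wq wp; rewrite qp in qC.
  have [q1 pq1 q1C] := Cinf_derive qC.
  by rewrite (antiderivative_unique pp1 pq1).
suff H k : Sk k w /\ Sk k p by split=> k; have [] := H k.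
elim: k => [|k [wk pk]]; first by split; split.
split; split=> //; first by exists p.
exists p1 => //; apply: Sk_divX p1C _.
rewrite [X in Sk _ X](_ : _ = fun x => 4^-1 * (nonlin (w x) + (- (2 * n.+1%:R)) * p x)).
  by apply: SkZ; apply: SkD; [exact: Sk_nonlin|exact: SkZ].
by apply/funext => x; rewrite -ode; field.
Qed.
End Solution.
End RapidSmooth.

(** * Radial Schwartz functions *)

Section Radial.
Context {R : realType} (d : nat).
Implicit Types (g : R -> R) (x : 'rV[R]_d) (i j : 'I_d) (t : R).

Definition sqnorm x : R := \sum_(i < d) x 0 i ^+ 2.

Lemma sqnorm_ge0 x : 0 <= sqnorm x.
Proof. by apply: sumr_ge0 => i _; exact: sqr_ge0. Qed.

Lemma derive_line (h : 'rV[R]_d -> R) x v :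
  'D_v h x = 'D_(1 : R) (fun t : R => h (t *: v + x)) (0 : R).
Proof.
rewrite /derive; set g1 := fun t => t^-1 *: _; set g2 := fun t => t^-1 *: _.
suff -> : g1 = g2 by [].
by rewrite funeqE /g1 /g2 => t /=; rewrite addr0 scale0r add0r [_%:A]mulr1.
Qed.

Lemma is_derive_line (h : 'rV[R]_d -> R) x v l :
  is_derive (0 : R) (1 : R) (fun t => h (t *: v + x)) l -> is_derive x v h l.
Proof.
move=> [D E]; apply: DeriveDef; first exact: (iffRL (derivable1P _ _ _) D).
by rewrite derive_line.
Qed.

Lemma line_coord x i j t :
  (t *: basis_vec R i + x) 0 j = (j == i)%:R * t + x 0 j.
Proof. by rewrite !mxE eqxx/= mulrC. Qed.

Lemma sqnorm_line x i t :
  sqnorm (t *: basis_vec R i + x) = t ^+ 2 + 2 * x 0 i * t + sqnorm x.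
Proof.
rewrite /sqnorm (bigD1 i)//= [in RHS](bigD1 i)//= line_coord eqxx mul1r.
under eq_bigr => j ji do rewrite line_coord (negbTE ji) mul0r add0r.
by ring.
Qed.

Lemma is_derive_radial g g' x i : antiderivative g g' ->
  is_derive x (basis_vec R i) (fun y => g (sqnorm y))
    (x 0 i * (2 * g' (sqnorm x))).
Proof.
move=> gg'; apply: is_derive_line.
under eq_fun do rewrite sqnorm_line.
have D : antiderivative (fun t => t ^+ 2 + 2 * x 0 i * t + sqnorm x)
    (fun t => 2 * t + 2 * x 0 i).
  apply: antiderivative_ext (antiderivativeD (antiderivativeD
    (@antiderivativeX R 1) (antiderivativeZ (2 * x 0 i) (@antiderivative_id R)))
    (antiderivative_cst (sqnorm x))) _ => t.
  by rewrite expr1; ring.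
apply: is_derive_eq (antiderivative_comp gg' D 0) _.
by rewrite expr0n/= !mulr0 !add0r; ring.
Qed.

Lemma is_derive_coordM (h : 'rV[R]_d -> R) x i j l :
  is_derive x (basis_vec R i) h l ->
  is_derive x (basis_vec R i) (fun y => y 0 j * h y)
    ((j == i)%:R * h x + x 0 j * l).
Proof.
move=> [/derivable1P D E]; apply: is_derive_line.
under eq_fun do rewrite line_coord.
have E' : is_derive (0 : R) (1 : R) (fun t => h (t *: basis_vec R i + x)) l.
  by apply: DeriveDef => //; rewrite -E derive_line.
have C : is_derive (0 : R) (1 : R) (fun t => (j == i)%:R * t + x 0 j) (j == i)%:R.
  have := antiderivativeD (antiderivativeZ (j == i)%:R (@antiderivative_id R))
    (antiderivative_cst (x 0 j)) 0.
  by rewrite mulr1 addr0.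
have -> : (fun t => ((j == i)%:R * t + x 0 j) * h (t *: basis_vec R i + x)) =
    (fun t => (j == i)%:R * t + x 0 j) * (fun t => h (t *: basis_vec R i + x)).
  by [].
apply: is_derive_eq.
by rewrite mulr0 add0r scale0r add0r /GRing.scale/=; ring.
Qed.

(** A class closed under all partial derivatives, because differentiating [g (|x| ^ 2)] only
    produces a coordinate and [g']. Being generated inductively, it needs no normal form for
    iterated derivatives. *)
Inductive radial_poly : ('rV[R]_d -> R) -> Prop :=
| radial_poly_radial g : Sinf g -> radial_poly (fun x => g (sqnorm x))
| radial_poly_coord i h : radial_poly h -> radial_poly (fun x => x 0 i * h x)
| radial_poly_add h1 h2 : radial_poly h1 -> radial_poly h2 ->
    radial_poly (fun x => h1 x + h2 x)
| radial_poly_scale c h : radial_poly h -> radial_poly (fun x => c * h x).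

Lemma radial_poly_derive h i : radial_poly h -> exists2 h', radial_poly h' &
  forall x, is_derive x (basis_vec R i) h (h' x).
Proof.
elim=> {h} [g gS|j h hP [h' h'P hh']|h1 h2 _ [h1' h1P H1] _ [h2' h2P H2]|c h _ [h' h'P hh']].
- have [_ [g' gg' _]] := gS 1%N; have g'S := Sinf_derive gS gg'.
  exists (fun x => x 0 i * (2 * g' (sqnorm x))).
    exact/radial_poly_coord/radial_poly_scale/radial_poly_radial.
  by move=> x; exact: is_derive_radial.
- exists (fun x => (j == i)%:R * h x + x 0 j * h' x).
    by apply: radial_poly_add; [exact: radial_poly_scale|exact: radial_poly_coord].
  by move=> x; exact: is_derive_coordM.
- exists (fun x => h1' x + h2' x); first exact: radial_poly_add.
  by move=> x; have := H1 x; have := H2 x => ? ?; exact: is_deriveD.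
- exists (fun x => c * h' x); first exact: radial_poly_scale.
  by move=> x; have := hh' x => ?; exact: is_deriveZ.
Qed.

Lemma radial_poly_partials s h : radial_poly h -> radial_poly (partials s h).
Proof.
elim: s => [//|i s IH] /IH /(radial_poly_derive i)[h' h'P hh'].
rewrite /= /partial (_ : 'D_ _ _ = h')//.
by apply/funext => x; have [_ <-] := hh' x.
Qed.

Lemma sqnorm_continuous : continuous sqnorm.
Proof.
apply: continuous_big => [|i _ x]; first exact: add_continuous.
apply: (@continuous_comp _ _ _ (fun y : 'rV[R]_d => y 0 i) (fun t => t ^+ 2)).
  exact: coord_continuous.
exact: exprn_continuous.
Qed.

Lemma radial_poly_continuous h : radial_poly h -> continuous h.
Proof.
elim=> {h} [g gS|j h _ hc|h1 h2 _ c1 _ c2|c h _ hc] x.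
- have [_ [g' gg' _]] := gS 1%N.
  apply: (@continuous_comp _ _ _ sqnorm g); first exact: sqnorm_continuous.
  exact: antiderivative_continuous gg' _.
- have c : continuous (fun y : 'rV[R]_d => y 0 j) by exact: coord_continuous.
  exact: cvgM (c x) (hc x).
- exact: cvgD (c1 x) (c2 x).
- exact: cvgM (cvg_cst c) (hc x).
Qed.

Lemma coord_le x i : `|x 0 i| <= 1 + sqnorm x.
Proof.
have H : x 0 i ^+ 2 <= sqnorm x.
  rewrite /sqnorm (bigD1 i)//= lerDl; apply: sumr_ge0 => j _; exact: sqr_ge0.
rewrite -real_normK ?num_real// in H.
by move: (`|x 0 i|) H (normr_ge0 (x 0 i)) => y; rewrite expr2; nra.
Qed.

(** The exponent is quantified inside the induction, as each coordinate factor uses up one power of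
    [1 + sqnorm x]. *)
Lemma radial_poly_bounded h : radial_poly h -> forall N, exists M, forall x,
  `|(1 + sqnorm x) ^+ N * h x| <= M.
Proof.
have p0 N x : 0 <= (1 + sqnorm x) ^+ N.
  by rewrite exprn_ge0// addr_ge0// sqnorm_ge0.
elim=> {h} [g gS|j h _ IH|h1 h2 _ IH1 _ IH2|c h _ IH] N.
- have [M0 H0] := Sk_rapid (gS 0%N) 0%N; have [M1 H1] := Sk_rapid (gS 0%N) N.
  exists (2 ^+ N * (M0 + M1)) => x; have s0 := sqnorm_ge0 x.
  have {}H0 := H0 _ s0; have {}H1 := H1 _ s0; rewrite expr0 mul1r in H0.
  move: (sqnorm x) s0 H0 H1 => s s0 H0 H1.
  rewrite normrM ger0_norm; last by rewrite exprn_ge0// addr_ge0.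
  rewrite normrM (ger0_norm (exprn_ge0 _ s0)) in H1.
  apply: (@le_trans _ _ (2 ^+ N * ((1 + s ^+ N) * `|g s|))); last first.
    by rewrite ler_wpM2l ?exprn_ge0// mulrDl mul1r lerD.
  rewrite mulrA ler_wpM2r//.
  have [s1|s1] := leP s 1.
    apply: (@le_trans _ _ (2 ^+ N)); first by rewrite lerXn2r ?nnegrE//; lra.
    by rewrite ler_peMr ?exprn_ge0// lerDl exprn_ge0.
  apply: (@le_trans _ _ (2 ^+ N * s ^+ N)).
    by rewrite -exprMn lerXn2r ?nnegrE//; lra.
  by rewrite ler_wpM2l ?exprn_ge0// lerDr.
- have [M HM] := IH N.+1; exists M => x; apply: le_trans (HM x).
  rewrite mulrCA mulrA !normrM ler_wpM2r// !(ger0_norm (p0 _ _)) exprS.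
  by rewrite ler_wpM2r// coord_le.
- have [M1 H1] := IH1 N; have [M2 H2] := IH2 N; exists (M1 + M2) => x.
  by rewrite mulrDr (le_trans (ler_normD _ _))// lerD.
- have [M HM] := IH N; exists (`|c| * M) => x.
  by rewrite mulrCA normrM ler_wpM2l.
Qed.

Lemma monomial_le (alpha : 'I_d -> nat) x :
  `|monomial alpha x| <= (1 + sqnorm x) ^+ (\sum_(i < d) alpha i).
Proof.
rewrite /monomial normr_prod expr_sum.
apply: ler_prod => i _; rewrite normr_ge0/= normrX lerXn2r ?nnegrE ?coord_le//.
by rewrite addr_ge0// sqnorm_ge0.
Qed.

Lemma schwartz_radial g : Sinf g -> schwartz (fun x => g (sqnorm x)).
Proof.
move=> gS; have P s := radial_poly_partials s (radial_poly_radial gS).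
split=> [s|alpha s].
  split; first exact: radial_poly_continuous.
  by move=> i x; have [h' _ H] := radial_poly_derive i (P s); have [] := H x.
have [M HM] := radial_poly_bounded (P s) (\sum_(i < d) alpha i).
exists M => x; apply: le_trans (HM x).
rewrite !normrM ler_wpM2r//; apply: le_trans (monomial_le _ _) _.
exact: ler_norm.
Qed.

Lemma partial_radial g g' i x : antiderivative g g' ->
  partial i (fun y => g (sqnorm y)) x = x 0 i * (2 * g' (sqnorm x)).
Proof. by move=> /(is_derive_radial x i)[]. Qed.

Lemma laplacian_radial g g' g'' x : antiderivative g g' ->
  antiderivative g' g'' ->
  laplacian (fun y => g (sqnorm y)) x =
    4 * sqnorm x * g'' (sqnorm x) + 2 * d%:R * g' (sqnorm x).
Proof.
move=> gg' gg''; rewrite /laplacian.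
have E i : partial i (partial i (fun y => g (sqnorm y))) x =
    x 0 i ^+ 2 * (4 * g'' (sqnorm x)) + 2 * g' (sqnorm x).
  have -> : partial i (fun y => g (sqnorm y)) = fun x => x 0 i * (2 * g' (sqnorm x)).
    by apply/funext => y; exact: partial_radial.
  have D := is_derive_coordM i (is_derive_radial x i (antiderivativeZ 2 gg'')).
  by rewrite /partial; have [_ ->] := D; rewrite eqxx mul1r; ring.
under eq_bigr do rewrite E.
rewrite big_split/= -mulr_suml sumr_const card_ord -mulr_natl -/(sqnorm x).
by ring.
Qed.

Lemma gradient_radial g g' x : antiderivative g g' ->
  enorm (gradient (fun y => g (sqnorm y)) x) ^+ 2 =
    4 * (sqnorm x * g' (sqnorm x) ^+ 2).
Proof.
move=> gg'; rewrite /enorm sqr_sqrtr; last by apply: sumr_ge0 => i _; exact: sqr_ge0.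
under eq_bigr do rewrite mxE (partial_radial _ _ gg') exprMn.
by rewrite -mulr_suml -/(sqnorm x); ring.
Qed.
End Radial.

(** * The fourth-order equation and its potential *)

Theorem theorem4p5 (R : realType) (d : nat) (hd : (3 <= d)%N) :
  exists v W : 'rV[R]_d -> R,
    [/\ schwartz v,
        schwartz W,
        (exists x, v x <> 0),
        (forall x, laplacian (laplacian v) x - v x + W x * v x = 0) &
        (forall x, W x =
           - 5 * v x ^+ 8 + 24 * v x ^+ 6 - 33 * v x ^+ 4 + 12 * v x ^+ 2
           - 20 * v x ^+ 2 * enorm (gradient v x) ^+ 2
           + 18 * enorm (gradient v x) ^+ 2)].
Proof.
case: d hd => [//|n] _.
have [w [p [p1 [[wp pp1 p1l] [pE ode w0 wr pr]]]]] := @ground_state_profile R n.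
have [wS pS] := solution_Sinf wp pp1 p1l pE ode wr pr.
pose v (x : 'rV[R]_n.+1) := w (sqnorm x).
(* [W] in the variable [s]: [|grad v| ^ 2] is [4 * s * p s ^ 2], whence 80 and 72. Powers are
   spelled out as products to match the closure lemmas for [Sk]. *)
pose G s := w s * (-5 * (w s * (w s * (w s * (w s * (w s * (w s * w s)))))) +
  (24 * (w s * (w s * (w s * (w s * w s)))) +
  (-33 * (w s * (w s * w s)) + 12 * w s)) +
  -80 * (w s * (s * (p s * p s)))) + 72 * (s * (p s * p s)).
have GS : Sinf G.
  move=> k; rewrite /G.
  by do !(first [exact: wS | exact: pS | apply: SkD | apply: SkZ | apply: Sk_mulX | apply: SkM]).
exists v, (fun x => G (sqnorm x)).
have WE x : G (sqnorm x) =
   - 5 * v x ^+ 8 + 24 * v x ^+ 6 - 33 * v x ^+ 4 + 12 * v x ^+ 2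
   - 20 * v x ^+ 2 * enorm (gradient v x) ^+ 2
   + 18 * enorm (gradient v x) ^+ 2.
  by rewrite (gradient_radial x wp) /G /v; ring.
split=> //.
- exact: schwartz_radial.
- exact: schwartz_radial.
- exists 0; rewrite /v (_ : sqnorm 0 = 0); first by apply/eqP; rewrite gt_eqF.
  by rewrite /sqnorm big1// => i _; rewrite mxE expr0n.
move=> x; rewrite WE (gradient_radial x wp).
have Dv : laplacian v = fun y => nonlin (w (sqnorm y)).
  apply/funext => y; rewrite (laplacian_radial y wp pp1) -ode; ring.
pose g1 s := nonlin' (w s) * p s.
have D1 : antiderivative (fun s => nonlin (w s)) g1.
  exact: antiderivative_comp (@antiderivative_nonlin R) wp.
pose nonlin'' (u : R) := - 18 * u + 20 * u ^+ 3.
have Df' : antiderivative (@nonlin' R) nonlin''.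
  have D := antiderivativeD (antiderivativeB (@antiderivative_cst R 1)
    (antiderivativeZ 9 (@antiderivativeX R 1)))
    (antiderivativeZ 5 (@antiderivativeX R 3)).
  by apply: antiderivative_ext D _ => u; rewrite /nonlin''; ring.
have D2 := antiderivativeM (antiderivative_comp Df' wp) pp1.
rewrite Dv (laplacian_radial x D1 D2) /g1 /comp /v.
have := ode (sqnorm x).
move: (sqnorm x) => s E.
(* The chain rule for the Laplacian of [f v] in radial form; the equation is used a second time to
   replace the Laplacian of [v] by [f v]. *)
have -> : 4 * s * (nonlin'' (w s) * p s * p s + nonlin' (w s) * p1 s) +
    2 * n.+1%:R * (nonlin' (w s) * p s) =
    4 * s * nonlin'' (w s) * p s ^+ 2 + nonlin' (w s) * nonlin (w s).
  by rewrite -E; ring.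
by rewrite /nonlin'' /nonlin' /nonlin; ring.
Qed.
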